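(* Let \(\mathcal M\) be a classifying space of type (I) or (II). Then the subgroup \[H=\{g\in G: Gr(g)\text{ is a real automorphism of }W_k/W_{k-2}\text{ for all }k\}\] acts transitively on \(\mathcal M\) by isometries; that is, \(H\) acts transitively on \(\mathcal M\), and for every \(g\in H\) and \(F\in\mathcal M\) the differential \(L_{g*}:T_F(\mathcal M)\to T_{g.F}(\mathcal M)\) of \(F\mapsto g.F\) is an isometry for the hermitian metric on \(T(\mathcal M)\) induced by the mixed Hodge metric.
   Context: \(V_{\mathbb Q}\) finite-dimensional over \(\mathbb Q\), \(V_{\mathbb R}=V_{\mathbb Q}\otimes\mathbb R\), \(V=V_{\mathbb Q}\otimes\mathbb C\), \(W\) an increasing rational filtration, \(Q=\{Q_k\}\) nondegenerate rational bilinear forms on \(Gr^W_k\) of parity \((-1)^k\). \(\mathcal M\) is the set of decreasing filtrations \(F\) of \(V\) with fixed \(\dim F^p\) such that \((F,W)\) is a mixed Hodge structure graded-polarized by \(Q\). \(G=\{g\in GL(V): g(W_k)=W_k\ \forall k,\ Gr(g)\text{ is a real automorphism of each }Q_k\}\); \(G_{\mathbb C}\) is defined with complex automorphisms; \(\mathfrak g_{\mathbb C}=\mathrm{Lie}(G_{\mathbb C})\). Deligne bigrading of \((F,W)\): unique \(V=\bigoplus I^{p,q}\) with \(F^p=\bigoplus_{a\ge p}I^{a,b}\), \(W_k=\bigoplus_{a+b\le k}I^{a,b}\), \(\overline{I^{p,q}}\equiv I^{q,p}\bmod\bigoplus_{r<q,s<p}I^{r,s}\); \(\mathfrak g^{r,s}_{\mathbb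 C}\) = elements of \(\mathfrak g_{\mathbb C}\) mapping \(I^{p,q}\) into \(I^{p+r,q+s}\). Type (I): for some \(k\), \(\dim I^{p,q}=0\) unless \(p+q\in\{k,k-1\}\); type (II): for some \(k\), \(\dim I^{p,q}=0\) unless \(p+q=2k-1\) or \((p,q)\in\{(k,k),(k-1,k-1)\}\). Metric. The mixed Hodge metric \(h_F\) on \(V\) makes the \(I^{p,q}\) orthogonal with \(h_F(u,v)=i^{p-q}Q_{p+q}([u],[\bar v])\) for \(u,v\in I^{p,q}\). \(T_F\mathcal M\) is identified with \(\mathfrak t_F=\bigoplus_{r<0}\mathfrak g^{r,s}_{\mathbb C}\) via \(u\mapsto\frac{d}{dt}\exp(tu).F|_{t=0}\), with hermitian metric \(h_F(\alpha,\beta)=\mathrm{Tr}(\alpha\beta^* )\), adjoint taken with respect to \(h_F\) on \(V\). *)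

(* Defs.v *)
From mathcomp Require Import all_boot all_order all_algebra.
From mathcomp Require Import complex.
From mathcomp Require Import reals.
Set Implicit Arguments. Unset Strict Implicit. Unset Printing Implicit Defensive.
Import Order.TTheory GRing.Theory Num.Theory.
Local Open Scope ring_scope.

(* Conventions.  V_Q = 'rV[rat]_n, V = 'rV[R[i]]_n.  Subspaces are row spaces
   of square matrices (mxalgebra, scope %MS).  A linear endomorphism g of V is
   the matrix acting on row vectors by v |-> v *m g, so g(S) is S *m g. *)

Section MHS.
Variables (R : realType) (n : nat).
Local Notation C := R[i].
Local Notation mx := 'M[C]_n.
Local Notation rv := 'rV[C]_n.

Definition conjm m (A : 'M[C]_(m, n)) : 'M[C]_(m, n) := map_mx Num.conj A.

Definition cW (W : int -> 'M[rat]_n) (k : int) : mx := map_mx ratr (W k).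
Definition cQ (Q : int -> 'M[rat]_n) (k : int) : mx := map_mx ratr (Q k).

Definition bil (B : mx) (u v : rv) : C := (u *m B *m v^T) 0 0.
Definition herm (H : mx) (u v : rv) : C := (u *m H *m (conjm v)^T) 0 0.

Definition zrange (N : nat) : seq int :=
  [seq (i%:Z - N%:Z) | i <- iota 0 (N.*2.+1)].

Definition incr_filtration (W : int -> 'M[rat]_n) : Prop :=
  (forall k, (W k <= W (k + 1)%R)%MS) /\
  exists a b : int, forall k, (k <= a -> (W k == (0 : 'M[rat]_n))%MS) /\ (b <= k -> (1%:M <= W k)%MS).

(* Q_k: a nondegenerate rational bilinear form on Gr^W_k = W_k / W_{k-1} of
   parity (-1)^k, represented by a (-1)^k-symmetric rational matrix Q k whose
   restriction to W_k has radical exactly W_{k-1}. *)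
Definition graded_forms (W Q : int -> 'M[rat]_n) : Prop :=
  forall k : int,
    (Q k)^T = ((-1) ^ k) *: Q k /\
    forall u : 'rV[rat]_n, (u <= W k)%MS ->
      ((forall v : 'rV[rat]_n, (v <= W k)%MS -> u *m Q k *m v^T = 0)
       <-> (u <= W (k - 1)%R)%MS).

Definition decr_filtration (F : int -> mx) : Prop :=
  (forall p, (F (p + 1)%R <= F p)%MS) /\
  exists a b : int, forall p, (p <= a -> (1%:M <= F p)%MS) /\ (b <= p -> (F p == (0 : mx))%MS).

(* lift to W_k of the subspace F^p Gr^W_k, and of its conjugate *)
Definition FGr (W : int -> 'M[rat]_n) (F : int -> mx) (p k : int) : mx :=
  (F p :&: cW W k + cW W (k - 1)%R)%MS.
Definition cFGr (W : int -> 'M[rat]_n) (F : int -> mx) (p k : int) : mx :=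
  (conjm (F p :&: cW W k) + cW W (k - 1)%R)%MS.

(* (F, W) is a mixed Hodge structure: F induces a pure Hodge structure of
   weight k on each Gr^W_k : Gr_k = F^p Gr_k (+) conj(F^{k-p+1} Gr_k). *)
Definition is_MHS (W : int -> 'M[rat]_n) (F : int -> mx) : Prop :=
  forall k p : int,
    (FGr W F p k + cFGr W F (k - p + 1)%R k == cW W k)%MS /\
    (FGr W F p k :&: cFGr W F (k - p + 1)%R k == cW W (k - 1)%R)%MS.

Definition graded_polarized (W Q : int -> 'M[rat]_n) (F : int -> mx) : Prop :=
  forall k p q : int, p + q = k ->
    (forall u v : rv, (u <= F p :&: cW W k)%MS -> (v <= F (k - p + 1)%R :&: cW W k)%MS ->
       bil (cQ Q k) u v = 0) /\
    (forall v : rv, (v <= FGr W F p k :&: cFGr W F q k)%MS -> ~~ (v <= cW W (k - 1)%R)%MS ->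
       0 < 'i ^ (p - q) * bil (cQ Q k) v (conjm v)).

Definition inM (W Q : int -> 'M[rat]_n) (f : int -> nat) (F : int -> mx) : Prop :=
  decr_filtration F /\ (forall p, \rank (F p) = f p) /\ is_MHS W F /\ graded_polarized W Q F.

Definition act (g : mx) (F : int -> mx) : int -> mx := fun p => F p *m g.

(* Gr(g) is real on W_k / W_{k-j} for every k *)
Definition real_mod (W : int -> 'M[rat]_n) (j : int) (g : mx) : Prop :=
  forall k (v : rv), (v <= cW W k)%MS -> ((conjm (v *m g) - conjm v *m g)%R <= cW W (k - j)%R)%MS.

Definition inG (W Q : int -> 'M[rat]_n) (g : mx) : Prop :=
  g \in unitmx /\ (forall k, (cW W k *m g == cW W k)%MS) /\ real_mod W 1 g /\
  (forall k (u v : rv), (u <= cW W k)%MS -> (v <= cW W k)%MS ->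
     bil (cQ Q k) (u *m g) (v *m g) = bil (cQ Q k) u v).

Definition inH (W Q : int -> 'M[rat]_n) (g : mx) : Prop := inG W Q g /\ real_mod W 2 g.

Definition in_gC (W Q : int -> 'M[rat]_n) (X : mx) : Prop :=
  (forall k, (cW W k *m X <= cW W k)%MS) /\
  (forall k (u v : rv), (u <= cW W k)%MS -> (v <= cW W k)%MS ->
     bil (cQ Q k) (u *m X) v + bil (cQ Q k) u (v *m X) = 0).

Definition Isum (N : nat) (P : int -> int -> bool) (I : int -> int -> mx) : mx :=
  (\sum_(a <- zrange N) \sum_(b <- zrange N | P a b) I a b)%MS.

Definition deligne (W : int -> 'M[rat]_n) (F : int -> mx) (N : nat) (I : int -> int -> mx) : Prop :=
  (forall p q, ~~ ((p \in zrange N) && (q \in zrange N)) -> (I p q == (0 : mx))%MS) /\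
  (* V = (+)_{p,q} I^{p,q} (direct sum) *)
  (\sum_(a <- zrange N) \sum_(b <- zrange N) \rank (I a b))%N = n /\
  (1%:M <= Isum N (fun _ _ => true) I)%MS /\
  (forall p, (F p == Isum N (fun a _ => (p <= a)%R) I)%MS) /\
  (forall k, (cW W k == Isum N (fun a b => (a + b <= k)%R) I)%MS) /\
  (forall p q,
     (conjm (I p q) + Isum N (fun r s => ((r < q) && (s < p))%R) I
      == I q p + Isum N (fun r s => ((r < q) && (s < p))%R) I)%MS).

Definition in_grs (W Q : int -> 'M[rat]_n) (I : int -> int -> mx) (r s : int) (X : mx) : Prop :=
  in_gC W Q X /\ forall p q, (I p q *m X <= I (p + r)%R (q + s)%R)%MS.

Definition in_tF (W Q : int -> 'M[rat]_n) (N : nat) (I : int -> int -> mx) (X : mx) : Prop :=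
  exists Xc : int -> int -> mx,
    (forall r s, in_grs W Q I r s (Xc r s)) /\
    X = \sum_(r <- zrange N.*2 | r < 0) \sum_(s <- zrange N.*2) Xc r s.

(* Lie algebra of the stabilizer of F in G_C (kernel of u |-> d/dt exp(tu).F) *)
Definition in_stab (W Q : int -> 'M[rat]_n) (F : int -> mx) (X : mx) : Prop :=
  in_gC W Q X /\ forall p, (F p *m X <= F p)%MS.

Definition mhs_metric (Q : int -> 'M[rat]_n) (I : int -> int -> mx) (Hm : mx) : Prop :=
  forall (p q p' q' : int) (u v : rv), (u <= I p q)%MS -> (v <= I p' q')%MS ->
    herm Hm u v =
      if (p == p') && (q == q') then 'i ^ (p - q) * bil (cQ Q (p + q)) u (conjm v) else 0.

Definition adjoint (Hm a b : mx) : Prop :=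
  forall u v : rv, herm Hm (u *m a) v = herm Hm u (v *m b).

Definition typeI (W Q : int -> 'M[rat]_n) (f : int -> nat) : Prop :=
  exists k : int, forall F N I, inM W Q f F -> deligne W F N I ->
    forall p q, \rank (I p q) != 0%N -> (p + q == k) || (p + q == k - 1).
Definition typeII (W Q : int -> 'M[rat]_n) (f : int -> nat) : Prop :=
  exists k : int, forall F N I, inM W Q f F -> deligne W F N I ->
    forall p q, \rank (I p q) != 0%N ->
      [|| p + q == 2 * k - 1, (p == k) && (q == k) | (p == k - 1) && (q == k - 1)].

End MHS.

(* Main.v *)
Require Import Defs.
From mathcomp Require Import all_boot all_order all_algebra.
From mathcomp Require Import complex boolp zify ring.
From mathcomp Require Import reals.
Set Implicit Arguments. Unset Strict Implicit. Unset Printing Implicit Defensive.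
Import Order.TTheory GRing.Theory Num.Theory.
Local Open Scope ring_scope.

(* Write k = p + q. Deligne's formula
     I^{p,q} = F^p /\ W_k /\ (conj F^q /\ W_k + sum_{j >= 2} conj F^{q-j+1} /\ W_{k-j})
   gives the bigrading of any mixed Hodge structure, and every bigrading with the
   defining properties is contained in it, hence equal to it.  Since conj I^{p,q} = I^{q,p}
   modulo W_{k-2}, an isomorphism I_F -> I_F' carrying frames that are orthonormal for the
   Hodge forms and compatible with this graded conjugation lies in H and sends F to F';
   it exists as soon as the Hodge numbers of F and F' agree, which in types (I) and (II)
   follows from the symmetry h^{p,q} = h^{q,p} and the fixed dimensions of F^p and W_k.
   For isometry, in types (I) and (II) the error W_{k-2} allowed by H is absorbed by the
   indeterminacy of conj I^{p,q}, so I.g satisfies the conditions characterizing I_{gF}: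
   g carries the bigrading, the metric and t_F of F to those of g.F. *)

(** The drop by 2 in the definition of H comes from Deligne's conjugation condition: r < q and s < p
    give r + s <= p + q - 2. Types (I) and (II) enter the isometry through the converse, called
    [tight] below: a nonzero I^{r,s} of weight at most p + q - 2 has r < q and s < p. In type (I) no
    two weights differ by 2; in type (II) the only such pair of cells is (k,k), (k-1,k-1).
    Containment of a bigrading in Deligne's formula is enough because two gradings of V, one
    contained cell by cell in the other, coincide. Matrices act on rows from the right, so the
    differential of F |-> g.F is u |-> g^-1 u g. Since g carries one bigrading to the other, this
    element already lies in t_{gF} and no correction by the stabilizer is needed. For frames the
    delicate cells are p = q: the graded conjugation maps I^{p,p} to itself, so the frame must
    consist of fixed vectors. For p <> q one frame is free and the other is its conjugate. *)

Ltac ilia :=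
  repeat match goal with
  | H : is_true (submx _ _) |- _ => clear H
  | H : @eq (matrix _ _ _) _ _ |- _ => clear H
  | H : forall x, _ |- _ => clear H
  end; lia.

Ltac zmod := apply/rowP => ?; rewrite !mxE; ring.

(** * Bigradings *)

(** Weight arguments start in the degrees where W vanishes, so the base case is a half-line and not
    a point. *)
Lemma int_up_ind (P : int -> Prop) (a : int) :
  (forall k, k <= a -> P k) -> (forall k, P (k - 1) -> P k) -> forall k, P k.
Proof.
move=> base step k; have [ka|ka] := leP k a; first exact: base.
have -> : k = a + `|k - a|%N by lia.
elim: `|k - a|%N => [|m IH]; first by apply: base; lia.
by apply: step; have -> : a + m.+1%:Z - 1 = a + m%:Z by lia.
Qed.

Lemma int_down_ind (P : int -> Prop) (b : int) :
  (forall k, b <= k -> P k) -> (forall k, P (k + 1) -> P k) -> forall k, P k.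
Proof.
move=> base step k; rewrite -[k]opprK.
apply: (@int_up_ind (fun k => P (- k)) (- b)) => {}k; first by move=> ?; apply: base; lia.
by move=> h; apply: step; have -> : - k + 1 = - (k - 1) by lia.
Qed.

Section RowSpaces.
Variables (K : fieldType) (n : nat).
Implicit Types v : 'rV[K]_n.

Lemma submx_sub m1 m2 (A B : 'M[K]_(m1, n)) (D : 'M[K]_(m2, n)) :
  (A <= D -> B <= D -> (A - B)%R <= D)%MS.
Proof. by move=> hA hB; rewrite addmx_sub // eqmx_opp. Qed.

Lemma sub_addsP m1 m2 (A : 'M[K]_(m1, n)) (B : 'M[K]_(m2, n)) v :
  (v <= A + B)%MS -> exists x y : 'rV_n, [/\ (x <= A)%MS, (y <= B)%MS & v = x + y].
Proof.
case/sub_addsmxP=> -[x y] /= ->; exists (x *m A), (y *m B).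
by rewrite !submxMl.
Qed.

Lemma adds_sub m1 m2 (A : 'M[K]_(m1, n)) (B : 'M[K]_(m2, n)) (x y : 'rV[K]_n) :
  (x <= A -> y <= B -> (x + y)%R <= A + B)%MS.
Proof.
by move=> hx hy; apply: addmx_sub; [apply: submx_trans hx (addsmxSl _ _)
  | apply: submx_trans hy (addsmxSr _ _)].
Qed.

Lemma capMunit (A B g : 'M[K]_n) : g \in unitmx ->
  ((A :&: B) *m g :=: A *m g :&: B *m g)%MS.
Proof.
move=> ug; apply/eqmxP/andP; split; first exact: capmxMr.
have := capmxMr (A *m g) (B *m g) (invmx g).
rewrite -!mulmxA mulmxV // !mulmx1 => /(submxMr g).
by rewrite -mulmxA mulVmx // mulmx1.
Qed.

Lemma subMunit m1 m2 (A : 'M[K]_(m1, n)) (B : 'M[K]_(m2, n)) (g : 'M[K]_n) :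
  g \in unitmx -> (A *m g <= B *m g)%MS = (A <= B)%MS.
Proof.
move=> ug; apply/idP/idP; last exact: submxMr.
by move/(submxMr (invmx g)); rewrite -!mulmxA mulmxV // !mulmx1.
Qed.

Lemma subMunitP m1 (v : 'M[K]_(m1, n)) (A g : 'M[K]_n) : g \in unitmx ->
  (v <= A *m g)%MS = (v *m invmx g <= A)%MS.
Proof.
by move=> ug; rewrite -[LHS](@subMunit _ _ _ _ (invmx g)) ?unitmx_inv // -mulmxA mulmxV // mulmx1.
Qed.

End RowSpaces.

Lemma mem_zrange N p : (p \in zrange N) = (`|p| <= N%:Z).
Proof.
apply/mapP/idP => [[j]|h].
  by rewrite mem_iota => hj ->; lia.
by exists (absz (p + N%:Z)); [rewrite mem_iota; lia | lia].
Qed.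

Lemma uniq_zrange N : uniq (zrange N).
Proof. by rewrite map_inj_uniq ?iota_uniq // => i j; lia. Qed.

Definition zrange2 (N : nat) : seq (int * int) :=
  [seq (a, b) | a <- zrange N, b <- zrange N].

Lemma mem_zrange2 N a b :
  ((a, b) \in zrange2 N) = (a \in zrange N) && (b \in zrange N).
Proof.
apply/allpairsP/andP => [[[x y] /= [hx hy [-> ->]]]|[ha hb]] //.
by exists (a, b).
Qed.

Lemma uniq_zrange2 N : uniq (zrange2 N).
Proof. by apply: allpairs_uniq; rewrite ?uniq_zrange //; case=> [a b] [c d] _ _. Qed.

Lemma big_zrange2 (T : Type) (idx : T) (op : Monoid.law idx) N
    (P : int -> int -> bool) (F : int -> int -> T) :
  \big[op/idx]_(a <- zrange N) \big[op/idx]_(b <- zrange N | P a b) F a b =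
  \big[op/idx]_(x <- zrange2 N | P x.1 x.2) F x.1 x.2.
Proof.
rewrite [RHS]big_mkcond big_allpairs_dep /=; apply: eq_bigr => a _.
by rewrite big_mkcond.
Qed.

(** Needed because t_F and t_{gF} are summed over windows with possibly different bounds [N] and
    [N']. *)
Lemma sum_seq_supp (V : zmodType) (T : eqType) (r s : seq T) (F : T -> V) :
  uniq r -> uniq s -> (forall x, F x != 0 -> (x \in r) && (x \in s)) ->
  \sum_(x <- r) F x = \sum_(x <- s) F x.
Proof.
have aux (r1 r2 : seq T) : (forall x, F x != 0 -> x \in r2) ->
    \sum_(x <- r1) F x = \sum_(x <- r1 | x \in r2) F x.
  move=> h; rewrite [RHS]big_mkcond; apply: eq_bigr => x _.
  by case: ifP => // hx; apply/eqP; apply: contraFT hx => /h.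
move=> ur us h; rewrite (aux r s) 1?(aux s r); try by move=> x /h/andP[].
rewrite -big_filter -[RHS]big_filter; apply: perm_big; apply: uniq_perm.
- exact: filter_uniq.
- exact: filter_uniq.
by move=> x; rewrite !mem_filter andbC.
Qed.

Section Bigradings.
Variables (R : realType) (n : nat).
Local Notation C := R[i].
Local Notation mx := 'M[C]_n.
Local Notation rv := 'rV[C]_n.

Definition csum N (P : int -> int -> bool) (I : int -> int -> mx) : nat :=
  (\sum_(x <- zrange2 N | P x.1 x.2) \rank (I x.1 x.2))%N.

Lemma IsumE N P (I : int -> int -> mx) :
  Isum N P I = (\sum_(x <- zrange2 N | P x.1 x.2) I x.1 x.2)%MS.
Proof. by rewrite /Isum -(big_zrange2 _ _ P I). Qed.

Lemma Isum_sub m N (P : int -> int -> bool) (I : int -> int -> mx) (B : 'M[C]_(m, n)) :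
  (forall a b, P a b -> (I a b <= B)%MS) -> (Isum N P I <= B)%MS.
Proof.
move=> h; rewrite IsumE; apply: (big_ind (fun X : mx => (X <= B)%MS)).
- exact: sub0mx.
- by move=> X Y hX hY; rewrite addsmx_sub hX.
- by move=> [a b] /=; exact: h.
Qed.

Definition supported N (I : int -> int -> mx) : Prop :=
  forall p q, ~~ ((p \in zrange N) && (q \in zrange N)) -> (I p q == (0 : mx))%MS.

Lemma sub_Isum N (P : int -> int -> bool) (I : int -> int -> mx) a b :
  supported N I -> P a b -> (I a b <= Isum N P I)%MS.
Proof.
move=> hI hP; have [hab|/hI/eqmx0P->] := boolP ((a \in zrange N) && (b \in zrange N));
  last exact: sub0mx.
rewrite IsumE big_mkcond (bigD1_seq (a, b)) ?uniq_zrange2 ?mem_zrange2 //= hP.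
exact: addsmxSl.
Qed.

Lemma rank_Isum_le N P (I : int -> int -> mx) : (\rank (Isum N P I) <= csum N P I)%N.
Proof.
rewrite IsumE /csum; apply: (big_ind2 (fun (X : mx) k => (\rank X <= k)%N)) => //.
- by rewrite mxrank0.
- by move=> X k Y l hX hY; apply: leq_trans (mxrank_adds_leqif _ _) (leq_add hX hY).
Qed.

Lemma csumD1 N (P P' : int -> int -> bool) (I : int -> int -> mx) p q :
  supported N I ->
  (forall a b, P a b = P' a b || ((a == p) && (b == q))) -> P' p q = false ->
  csum N P I = (csum N P' I + \rank (I p q))%N.
Proof.
move=> hI hP hP'; rewrite /csum.
have [hab|nab] := boolP ((p \in zrange N) && (q \in zrange N)).
  rewrite big_mkcond (bigD1_seq (p, q)) ?uniq_zrange2 ?mem_zrange2 //=.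
  rewrite [X in _ = (X + _)%N]big_mkcond [X in _ = (X + _)%N](bigD1_seq (p, q))
    ?uniq_zrange2 ?mem_zrange2 //=.
  rewrite hP hP' !eqxx /= add0n addnC; congr (_ + _)%N.
  apply: eq_bigr => -[a b] /=; rewrite xpair_eqE => /negbTE h.
  by rewrite hP h orbF.
rewrite (eqmx0P (hI _ _ nab)) mxrank0 addn0 big_mkcond [RHS]big_mkcond.
apply: eq_big_seq => -[a b]; rewrite mem_zrange2 => hab /=.
rewrite hP; have -> : (a == p) && (b == q) = false; last by rewrite orbF.
by apply: contraNF nab => /andP[/eqP <- /eqP <-].
Qed.

Lemma csum_eq N (P P' : int -> int -> bool) (I : int -> int -> mx) :
  (forall a b, \rank (I a b) != 0%N -> P a b = P' a b) -> csum N P I = csum N P' I.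
Proof.
move=> h; rewrite /csum big_mkcond [RHS]big_mkcond; apply: eq_bigr => -[a b] _ /=.
have [->|/h->//] := eqVneq (\rank (I a b)) 0%N; by do 2 case: ifP.
Qed.

Lemma csumC N (P : int -> int -> bool) (I : int -> int -> mx) :
  (csum N P I + csum N (fun a b => ~~ P a b) I)%N = csum N (fun _ _ => true) I.
Proof. by rewrite /csum [RHS](bigID (fun x => P x.1 x.2)). Qed.

Lemma Isum_mono N (P P' : int -> int -> bool) (I : int -> int -> mx) :
  supported N I -> (forall a b, P a b -> P' a b) -> (Isum N P I <= Isum N P' I)%MS.
Proof. by move=> hI h; apply: Isum_sub => a b /h; exact: sub_Isum. Qed.

(** Directness is encoded as a dimension count, as in [deligne]; [bproj_cap] recovers the
    independence of each cell from the others. *)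
Definition bigraded N (I : int -> int -> mx) : Prop :=
  [/\ supported N I, csum N (fun _ _ => true) I = n
    & (1%:M <= Isum N (fun _ _ => true) I)%MS].

Definition bproj N (I : int -> int -> mx) a b : mx :=
  proj_mx (I a b) (Isum N (fun c d => ~~ ((c == a) && (d == b))) I).

Section Projections.
Variables (N : nat) (I : int -> int -> mx).
Hypothesis hI : bigraded N I.
Local Notation pi := (bproj N I).

Lemma bigraded_supp : supported N I. Proof. by case: hI. Qed.
Local Hint Resolve bigraded_supp : core.

(** The sums over [P] and over its complement have ranks bounded by their [csum], and together they
    span a space of dimension n, the total [csum]; so neither bound can be strict. *)
Lemma rank_Isum P : \rank (Isum N P I) = csum N P I.
Proof.
case: hI => _ hn h1; apply/eqP; rewrite eqn_leq rank_Isum_le /=.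
have : (n <= \rank (Isum N P I) + \rank (Isum N (fun a b => ~~ P a b) I))%N.
  rewrite -[X in (X <= _)%N](@mxrank1 C n).
  apply: leq_trans (mxrank_adds_leqif _ _); apply: mxrankS.
  apply: submx_trans h1 _; apply: Isum_sub => a b _.
  have [hP|hP] := boolP (P a b).
    exact: submx_trans (sub_Isum _ hP) (addsmxSl _ _).
  exact: submx_trans (sub_Isum (P := fun a b => ~~ P a b) _ hP) (addsmxSr _ _).
have := rank_Isum_le N (fun a b => ~~ P a b) I; have := csumC N P I; lia.
Qed.

Lemma bproj_cap a b :
  (I a b :&: Isum N (fun c d => ~~ ((c == a) && (d == b))) I)%MS = 0.
Proof.
apply/eqP; rewrite -mxrank_eq0; set A := I a b; set B := Isum _ _ _.
have := mxrank_sum_cap A B; rewrite (rank_Isum (fun c d => ~~ ((c == a) && (d == b)))).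
have : \rank (A + B) = n.
  apply/eqP; rewrite -[_ == _]/(row_full _) -sub1mx.
  case: hI => _ _ h1; apply: submx_trans h1 _; apply: Isum_sub => c d _.
  have [/andP[/eqP-> /eqP->]|hP] := boolP ((c == a) && (d == b)); first exact: addsmxSl.
  apply: submx_trans (addsmxSr _ _).
  exact: (sub_Isum (P := fun c d => ~~ ((c == a) && (d == b)))).
have : csum N (fun _ _ => true) I = n by case: hI.
rewrite (csumD1 (P' := fun c d => ~~ ((c == a) && (d == b))) bigraded_supp (p := a) (q := b)).
- by rewrite -/A; lia.
- by move=> c d; rewrite orNb.
- by rewrite !eqxx.
Qed.

Lemma bproj_sub m a b (v : 'M[C]_(m, n)) : (v *m pi a b <= I a b)%MS.
Proof. exact: proj_mx_sub. Qed.

Lemma bproj_id m a b (v : 'M[C]_(m, n)) : (v <= I a b)%MS -> v *m pi a b = v.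
Proof. by apply: proj_mx_id; exact: bproj_cap. Qed.

Lemma bproj_0 m a b c d (v : 'M[C]_(m, n)) :
  (v <= I c d)%MS -> ~~ ((c == a) && (d == b)) -> v *m pi a b = 0.
Proof.
move=> hv h; apply: proj_mx_0 (bproj_cap a b) _; apply: submx_trans hv _.
exact: (sub_Isum (P := fun c d => ~~ ((c == a) && (d == b)))).
Qed.

Lemma bigraded_ext m (M1 M2 : 'M[C]_(n, m)) :
  (forall a b (v : rv), (v <= I a b)%MS -> v *m M1 = v *m M2) -> M1 = M2.
Proof.
move=> h; apply/eqP; rewrite -subr_eq0 -[_ - _]mul1mx; apply/eqP/sub_kermxP.
case: hI => _ _ h1; apply: submx_trans h1 _; apply: Isum_sub => a b _.
by apply/rV_subP => v /h hv; apply/sub_kermxP; rewrite mulmxBr hv subrr.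
Qed.

Lemma bproj_sum : \sum_(x <- zrange2 N) pi x.1 x.2 = 1%:M.
Proof.
apply: bigraded_ext => a b v hv; rewrite mulmx1 mulmx_sumr.
have [hab|/bigraded_supp/eqmx0P h0] := boolP ((a \in zrange N) && (b \in zrange N)).
  rewrite (bigD1_seq (a, b)) ?uniq_zrange2 ?mem_zrange2 //= bproj_id // big1 ?addr0 //.
  by move=> [c d]; rewrite xpair_eqE => h; apply: (bproj_0 hv); rewrite eq_sym [b == _]eq_sym.
move: hv; rewrite h0 submx0 => /eqP->; rewrite big1 // => x _.
exact: mul0mx.
Qed.

Lemma bproj_decomp m (v : 'M[C]_(m, n)) : v = \sum_(x <- zrange2 N) v *m pi x.1 x.2.
Proof. by rewrite -mulmx_sumr bproj_sum mulmx1. Qed.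

(** Membership becomes a condition on components, which turns intersections of partial sums
    ([Isum_cap]) into a computation on index sets. *)
Lemma sub_IsumP m (P : int -> int -> bool) (v : 'M[C]_(m, n)) :
  (v <= Isum N P I)%MS <-> forall a b, ~~ P a b -> v *m pi a b = 0.
Proof.
split=> [hv a b hab|h].
  apply/sub_kermxP; apply: submx_trans hv _; apply: Isum_sub => c d hcd.
  apply/sub_kermxP; apply: (bproj_0 (submx_refl _)).
  by apply: contra hab => /andP[/eqP <- /eqP <-].
rewrite [v]bproj_decomp; apply: (big_ind (fun X : 'M_(m, n) => (X <= Isum N P I)%MS)).
- exact: sub0mx.
- by move=> X Y; apply: addmx_sub.
move=> [a b] _ /=; have [hab|/h->] := boolP (P a b); last exact: sub0mx.
exact: submx_trans (bproj_sub _ _ _) (sub_Isum _ hab).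
Qed.

Lemma Isum_split m (P P1 P2 : int -> int -> bool) (v : 'M[C]_(m, n)) :
  (forall a b, P a b -> P1 a b || P2 a b) -> (v <= Isum N P I)%MS ->
  (v <= Isum N P1 I + Isum N P2 I)%MS.
Proof.
move=> h hv; apply: submx_trans hv _; apply: Isum_sub => a b /h /orP[h1|h2].
- exact: submx_trans (sub_Isum _ h1) (addsmxSl _ _).
- exact: submx_trans (sub_Isum _ h2) (addsmxSr _ _).
Qed.

Lemma Isum_cap m (P P1 P2 : int -> int -> bool) (v : 'M[C]_(m, n)) :
  (forall a b, P1 a b -> P2 a b -> P a b) ->
  (v <= Isum N P1 I)%MS -> (v <= Isum N P2 I)%MS -> (v <= Isum N P I)%MS.
Proof.
move=> h /sub_IsumP h1 /sub_IsumP h2; apply/sub_IsumP => a b hP.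
have [|/h1//] := boolP (P1 a b); have [|/h2//] := boolP (P2 a b).
by move=> p2 p1; rewrite (h a b p1 p2) in hP.
Qed.

End Projections.
End Bigradings.

(** * Opposed filtrations *)

Section Tail.
Variables (R : realType) (n : nat).
Local Notation C := R[i].
Local Notation mx := 'M[C]_n.
Local Notation rv := 'rV[C]_n.

(* [tail W G a q k] is the sum of G^{q-j} /\ W_{k-j} over j >= 0; it is finite
   because W vanishes in weights <= a. *)
Fixpoint tail_rec (W G : int -> mx) (m : nat) (q k : int) : mx :=
  if m is m'.+1 then (G q :&: W k + tail_rec W G m' (q - 1) (k - 1))%MS else 0.

Definition tail (W G : int -> mx) (a q k : int) : mx := tail_rec W G `|k - a|%N q k.

Variables (W G : int -> mx) (a : int).
Hypothesis W0 : forall k : int, k <= a -> W k = 0.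
Hypothesis Wmono : forall j k : int, j <= k -> (W j <= W k)%MS.
Hypothesis Gmono : forall p q : int, p <= q -> (G q <= G p)%MS.
Local Notation T := (tail W G a).

Lemma tail_rec_W m q k : (tail_rec W G m q k <= W k)%MS.
Proof.
elim: m q k => [|m IH] q k /=; first exact: sub0mx.
rewrite addsmx_sub capmxSr /=; apply: submx_trans (IH _ _) (Wmono _); ilia.
Qed.

Lemma tail_W q k : (T q k <= W k)%MS.
Proof. exact: tail_rec_W. Qed.

Lemma tail_0 (q k : int) : k <= a -> T q k = 0.
Proof. by move=> /W0 h; apply/eqP; rewrite -submx0 -h tail_W. Qed.

Lemma tailE q k : (T q k :=: G q :&: W k + T (q - 1) (k - 1))%MS.
Proof.
have [ka|ka] := leP k a.
  by rewrite !tail_0 ?W0 ?capmx0 ?addsmx0_id //; ilia.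
rewrite /tail; have -> : `|k - a|%N = (absz (k - 1 - a)%R).+1 by ilia.
exact: eqmx_refl.
Qed.

Lemma sub_tail q k : (G q :&: W k <= T q k)%MS.
Proof. by rewrite tailE addsmxSl. Qed.

Lemma tail_diag q k : (T (q - 1) (k - 1) <= T q k)%MS.
Proof. by rewrite (tailE q k) addsmxSr. Qed.

Lemma tail_mono (q q' k k' : int) : q' <= q -> k <= k' -> (T q k <= T q' k')%MS.
Proof.
move: k q q' k'; apply: (@int_up_ind _ a) => [k ka|k IH] q q' k' hq hk.
  by rewrite tail_0 // sub0mx.
rewrite (tailE q k) (tailE q' k') addsmxS ?capmxS ?Gmono ?Wmono // IH //; ilia.
Qed.

(** With m = k' - k, m diagonal steps lead from (q' - m, k) to (q', k'), and the second hypothesis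
    says q' - m <= q, which is monotonicity in q. *)
Lemma tail_le (q q' k k' : int) : k <= k' -> q' - k' <= q - k -> (T q k <= T q' k')%MS.
Proof.
move=> hk hq; have -> : k' = k + `|k' - k|%N by ilia.
have : q' - `|k' - k|%N%:Z <= q by ilia.
elim: `|k' - k|%N q' {hk hq} => [|m IH] q' hq.
  by apply: tail_mono; ilia.
apply: submx_trans (tail_diag _ _).
have -> : k + m.+1%:Z - 1 = k + m%:Z by ilia.
by apply: IH; ilia.
Qed.

Lemma tail_ind (S : mx) q k :
  (forall j : nat, (G (q - j%:Z) :&: W (k - j%:Z) <= S)%MS) -> (T q k <= S)%MS.
Proof.
rewrite /tail; move: `|k - a|%N => m; elim: m q k => [|m IH] q k h /=; first exact: sub0mx.
rewrite addsmx_sub; have /= := h 0%N; rewrite !subr0 => -> /=.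
apply: IH => j; have := h j.+1.
have -> : q - j.+1%:Z = q - 1 - j%:Z by ilia.
by have -> : k - j.+1%:Z = k - 1 - j%:Z by ilia.
Qed.

End Tail.

Section Opposed.
Variables (R : realType) (n : nat).
Local Notation C := R[i].
Local Notation mx := 'M[C]_n.
Local Notation rv := 'rV[C]_n.

(** F and G induce k-opposed filtrations on each Gr_k; G stays abstract since the splitting does not
    use that it is conj F. The last two bounds ensure that a cell outside the square [-N, N]^2 has p
    >= b', q >= b' or p + q <= a, each of which makes it zero. *)
Record opposed (W F G : int -> mx) (a b a' b' : int) (N : nat) : Prop := Opposed {
  opp_W0 : forall k : int, k <= a -> W k = 0;
  opp_W1 : forall k : int, b <= k -> (1%:M <= W k)%MS;
  opp_F1 : forall p : int, p <= a' -> (1%:M <= F p)%MS;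
  opp_F0 : forall p : int, b' <= p -> F p = 0;
  opp_G0 : forall p : int, b' <= p -> G p = 0;
  opp_Wmono : forall j k : int, j <= k -> (W j <= W k)%MS;
  opp_Fmono : forall p q : int, p <= q -> (F q <= F p)%MS;
  opp_Gmono : forall p q : int, p <= q -> (G q <= G p)%MS;
  opposed_sum : forall p q k : int, p + q = k + 1 ->
    (W k <= F p :&: W k + G q :&: W k + W (k - 1))%MS;
  opposed_cap : forall (p q k : int) (x y : rv), p + q = k + 1 ->
    (x <= F p :&: W k)%MS -> (y <= G q :&: W k)%MS -> ((x - y)%R <= W (k - 1))%MS ->
    (x <= W (k - 1))%MS;
  opp_N_ge : b' <= N%:Z;
  opp_N_le : - N%:Z <= a - b' }.

Variables (W F G : int -> mx) (a b a' b' : int) (N : nat).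
Hypothesis opp : opposed W F G a b a' b' N.
Let W0 := opp_W0 opp.
Let W1 := opp_W1 opp.
Let F1 := opp_F1 opp.
Let F0 := opp_F0 opp.
Let G0 := opp_G0 opp.
Let Wmono := opp_Wmono opp.
Let Fmono := opp_Fmono opp.
Let Gmono := opp_Gmono opp.
Let opp_sum := opposed_sum opp.
Let opp_cap := opposed_cap opp.
Let N_ge := opp_N_ge opp.
Let N_le := opp_N_le opp.

Local Notation T := (tail W G a).

(** With [tail_inj] this gives W_k = F^p /\ W_k (+) T(q,k). Lowering q together with the weight
    keeps p + q = k + 1 valid on each lower graded piece, so opposedness applies again to the
    remainder. *)
Lemma tail_surj (p q k : int) : p + q = k + 1 -> (W k <= F p :&: W k + T q k)%MS.
Proof.
move: k p q; apply: (@int_up_ind _ a) => [k ka|k IH] p q hpq; first by rewrite W0 // sub0mx.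
apply/rV_subP => v /submx_trans/(_ (opp_sum hpq)).
case/sub_addsP=> xy [w [/sub_addsP[x [y [hx hy ->]]] hw ->]].
have /(submx_trans hw) : (W (k - 1) <= F p :&: W (k - 1) + T (q - 1) (k - 1))%MS.
  by apply: IH; ilia.
case/sub_addsP=> x' [t [hx' ht ->]].
have -> : x + y + (x' + t) = (x + x') + (y + t) by rewrite addrACA.
apply: adds_sub.
  apply: addmx_sub hx (submx_trans hx' _); apply: capmxS => //.
  by apply: Wmono; ilia.
by rewrite tailE //; apply: adds_sub.
Qed.

Lemma tail_inj (p q k : int) (v : rv) : p + q = k + 1 ->
  (v <= F p)%MS -> (v <= T q k)%MS -> v = 0.
Proof.
move: k p q v; apply: (@int_up_ind _ a) => [k ka|k IH] p q v hpq hF hT.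
  by move: hT; rewrite tail_0 // submx0 => /eqP.
have vW := submx_trans hT (tail_W G a Wmono _ _).
move: hT; rewrite tailE // => /sub_addsP[y [t [hy ht def]]].
have tW := submx_trans ht (tail_W G a Wmono _ _).
have vW' : (v <= W (k - 1))%MS.
  apply: (opp_cap hpq _ hy); first by rewrite sub_capmx hF.
  by rewrite def addrC addKr.
have yW : (y <= W (k - 1))%MS.
  have -> : y = v - t by rewrite def addrK.
  exact: submx_sub.
apply: (IH p (q - 1)) => //; first by ilia.
rewrite def; apply: addmx_sub ht.
apply: submx_trans (sub_tail _ W0 Wmono _ _).
rewrite sub_capmx yW andbT.
by move: hy; rewrite sub_capmx => /andP[/submx_trans h _]; apply/h/Gmono; ilia.
Qed.

(** The bracket of Deligne's formula: with j = i + 2, the term G^{q-1-i} /\ W_{k-2-i} of the tail is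
    G^{q-j+1} /\ W_{k-j}. *)
Definition delA (q k : int) : mx := (G q :&: W k + T (q - 1) (k - 2))%MS.

Definition delJ (p q : int) : mx := (F p :&: W (p + q) :&: delA q (p + q))%MS.

Lemma delJ_F p q : (delJ p q <= F p)%MS.
Proof. by rewrite /delJ -capmxA capmxSl. Qed.

Lemma delJ_W p q : (delJ p q <= W (p + q))%MS.
Proof. exact: submx_trans (capmxSl _ _) (capmxSr _ _). Qed.

Lemma delJ_A p q : (delJ p q <= delA q (p + q))%MS.
Proof. exact: capmxSr. Qed.

(** Write v = y + t as in [delA]. Opposedness in weight p+q-1 pushes v, hence y, into W_{p+q-2};
    there y is absorbed by the tail and [tail_inj] applies. *)
Lemma delJ_inj (p q : int) (v : rv) : (v <= delJ p q)%MS -> (v <= W (p + q - 1))%MS -> v = 0.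
Proof.
move=> hJ hW; have hF := submx_trans hJ (delJ_F p q).
have /sub_addsP[y [t [hy ht def]]] := submx_trans hJ (delJ_A p q).
have tW := submx_trans ht (tail_W G a Wmono _ _).
have yG : (y <= G q)%MS by apply: submx_trans hy (capmxSl _ _).
have yW : (y <= W (p + q - 1))%MS.
  have -> : y = v - t by rewrite def addrK.
  by apply: submx_sub hW (submx_trans tW (Wmono _)); ilia.
have e2 : p + q - 1 - 1 = p + q - 2 by ilia.
have vW : (v <= W (p + q - 2))%MS.
  rewrite -e2; apply: (@opp_cap p q _ v y); [ilia|..].
  - by rewrite sub_capmx hF.
  - by rewrite sub_capmx yG.
  - by rewrite e2 def addrC addKr.
apply: (@tail_inj p (q - 1) (p + q - 2)) => //; first by ilia.
rewrite def; apply: addmx_sub ht.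
apply: submx_trans (sub_tail _ W0 Wmono _ _).
rewrite sub_capmx; apply/andP; split; first by apply: submx_trans yG (Gmono _); ilia.
have -> : y = v - t by rewrite def addrK.
exact: submx_sub.
Qed.

Definition FW (p k : int) : mx := (F p :&: W k + W (k - 1))%MS.

Lemma delJ_cap (p k : int) : (delJ p (k - p) :&: FW (p + 1) k)%MS = 0.
Proof.
apply/eqP; rewrite -submx0; apply/rV_subP => v; rewrite sub_capmx => /andP[hJ].
case/sub_addsP=> x [w [hx hw def]].
have /sub_addsP[y [t [hy ht def']]] := submx_trans hJ (delJ_A p (k - p)).
have tW := submx_trans ht (tail_W G a Wmono _ _).
have ek : p + (k - p) = k by ilia.
rewrite ek in hy tW.
have xW : (x <= W (k - 1))%MS.
  apply: (@opp_cap (p + 1) (k - p) _ x y) => //; first by ilia.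
  have -> : x - y = t - w by rewrite -[x](addrK w) -def def'; zmod.
  by apply: submx_sub hw; apply: submx_trans tW (Wmono _); ilia.
rewrite (@delJ_inj p (k - p) v) ?sub0mx // ek def.
exact: addmx_sub.
Qed.

(** The point is surjectivity onto Gr_F^p Gr^W_k. A vector v of F^p /\ W_k is corrected by elements
    of F^p: opposedness for (p+1, k-p) in weight k, for (p, k-p) in weight k-1, and [tail_surj] for
    (p, k-p-1) in weight k-2. What remains of v lies in [delA]. *)
Lemma delJ_sum (p k : int) : (delJ p (k - p) + FW (p + 1) k :=: FW p k)%MS.
Proof.
have ek : p + (k - p) = k by ilia.
apply/eqmxP/andP; split.
  rewrite addsmx_sub; apply/andP; split.
    apply: submx_trans (addsmxSl _ _); rewrite sub_capmx delJ_F /=.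
    by have := delJ_W p (k - p); rewrite ek.
  by apply: addsmxS => //; apply: capmxS => //; apply: Fmono; ilia.
rewrite addsmx_sub; apply/andP; split; last first.
  by apply: submx_trans (addsmxSr _ _); exact: addsmxSr.
apply/rV_subP => v hv; have := hv; rewrite sub_capmx => /andP[vF vW].
have /(submx_trans vW) : (W k <= F (p + 1) :&: W k + G (k - p) :&: W k + W (k - 1))%MS.
  by apply: opp_sum; ilia.
case/sub_addsP=> xy [w [/sub_addsP[x [y [hx hy ->]]] hw def]].
have e1 : k - 1 - 1 = k - 2 by ilia.
have /(submx_trans hw) : (W (k - 1) <= F p :&: W (k - 1) + G (k - p) :&: W (k - 1) + W (k - 2))%MS.
  by rewrite -e1; apply: opp_sum; ilia.
case/sub_addsP=> xy1 [w1 [/sub_addsP[x1 [y1 [hx1 hy1 ->]]] hw1 defw]].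
have /(submx_trans hw1) : (W (k - 2) <= F p :&: W (k - 2) + T (k - p - 1) (k - 2))%MS.
  by apply: tail_surj; ilia.
case/sub_addsP=> x2 [t [hx2 ht defw1]].
have WW j : j <= k -> (F p :&: W j <= F p :&: W k)%MS by move=> ?; rewrite capmxS ?Wmono.
have hx' : (x <= F p :&: W k)%MS.
  by apply: submx_trans hx (capmxS _ (submx_refl _)); apply: Fmono; ilia.
have -> : v = (v - x - x1 - x2) + (x + (x1 + x2)) by zmod.
apply: adds_sub; last first.
  apply: adds_sub => //; apply: addmx_sub.
    exact: submx_trans hx1 (capmxSr _ _).
  by apply: submx_trans (submx_trans hx2 (capmxSr _ _)) (Wmono _); ilia.
rewrite /delJ ek sub_capmx; apply/andP; split.
  apply: submx_sub; last by apply: submx_trans hx2 (WW _ _); ilia.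
  apply: submx_sub; last by apply: submx_trans hx1 (WW _ _); ilia.
  exact: submx_sub.
have -> : v - x - x1 - x2 = (y + y1) + t by rewrite def defw defw1; zmod.
apply: adds_sub ht; apply: addmx_sub => //.
apply: submx_trans hy1 (capmxS _ _) => //; apply: Wmono; ilia.
Qed.


Lemma delJ_supp : supported N delJ.
Proof.
move=> p q hpq; apply/eqmx0P/eqP; rewrite -submx0; apply/rV_subP => v hv.
rewrite submx0; apply/eqP.
have [hp|hp] := leP b' p.
  by move: (submx_trans hv (delJ_F p q)); rewrite F0 // submx0 => /eqP.
have [hq|hq] := leP b' q.
  apply: (delJ_inj hv); move: (submx_trans hv (delJ_A p q)).
  rewrite /delA G0 // cap0mx adds0mx => /submx_trans/(_ (tail_W G a Wmono _ _)).
  by move=> /submx_trans; apply; apply: Wmono; ilia.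
have [hk|hk] := leP (p + q) a.
  by move: (submx_trans hv (delJ_W p q)); rewrite W0 // submx0 => /eqP.
by move: hpq; rewrite !mem_zrange; ilia.
Qed.

Lemma delJ_rank_range p q : \rank (delJ p q) != 0%N ->
  (- N%:Z <= p) && (p <= N%:Z) && (- N%:Z <= q) && (q <= N%:Z).
Proof.
have [|/delJ_supp/eqmx0P->] := boolP ((p \in zrange N) && (q \in zrange N));
  last by rewrite mxrank0.
by rewrite !mem_zrange => h _; ilia.
Qed.

Lemma csum_delJ k : csum N (fun c d => c + d <= k) delJ = \rank (W k).
Proof.
move: k; apply: (@int_up_ind _ a) => [k ka|k IH].
  rewrite W0 // mxrank0 /csum big1 // => -[c d] /= hcd; apply/eqP; rewrite mxrank_eq0.
  by rewrite -submx0 -(W0 (k := c + d)) ?delJ_W //; ilia.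
(* A flag between W_{k-1} and W_k: lowering p by one adds the single cell (p, k-p). *)
pose P p c d : bool := (c + d <= k - 1) || ((c + d == k) && (p <= c)).
have key p : csum N (P p) delJ = \rank (FW p k).
  move: p; apply: (@int_down_ind _ b') => [p hp|p IHp].
    rewrite /FW F0 // cap0mx adds0mx -IH; apply: csum_eq => c d hcd; rewrite /P.
    suff -> : (p <= c) = false by rewrite andbF orbF.
    apply: contraNF hcd => hpc; rewrite mxrank_eq0 -submx0 -(F0 (p := c)) ?delJ_F //; ilia.
  rewrite -delJ_sum mxrank_disjoint_sum ?delJ_cap // -IHp addnC.
  apply: csumD1; first exact: delJ_supp.
  - by move=> c d; rewrite /P; ilia.
  - by rewrite /P; ilia.
(* At or below a' the filtration F is everything; at or below -N no cell of weight k is left out. *)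
have -> : \rank (W k) = \rank (FW (Num.min a' (- N%:Z)) k).
  rewrite /FW; apply: eqmx_rank; apply/andP; split.
    apply: submx_trans (addsmxSl _ _); rewrite sub_capmx submx_refl andbT.
    by apply: submx_trans (submx1 _) (F1 _); ilia.
  by rewrite addsmx_sub capmxSr Wmono //; ilia.
rewrite -key; apply: csum_eq => c d /delJ_rank_range; rewrite /P; ilia.
Qed.

(** Induction upward on k and downward on p. In the decomposition of v given by [delJ_sum], the term
    w of W_{k-1} lies in F^p too, because v and the other terms do; the induction on k then applies
    with the same p. *)
Lemma delJ_span_FW k p :
  (F p :&: W k <= Isum N (fun c d => (p <= c) && (c + d <= k))%R delJ)%MS.
Proof.
move: k p; apply: (@int_up_ind _ a) => [k ka|k IH] p.
  by rewrite W0 // capmx0 sub0mx.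
move: p; apply: (@int_down_ind _ b') => [p hp|p IHp].
  by rewrite F0 // cap0mx sub0mx.
apply/rV_subP => v hv; have : (v <= FW p k)%MS by apply: submx_trans hv (addsmxSl _ _).
rewrite -delJ_sum => /sub_addsP[x [zw [hx /sub_addsP[z [w [hz hw ->]]] def]]].
have xF := submx_trans hx (delJ_F _ _).
have wF : (w <= F p :&: W (k - 1))%MS.
  rewrite sub_capmx hw andbT; have -> : w = v - x - z by rewrite def; zmod.
  move: hv hz; rewrite !sub_capmx => /andP[hv _] /andP[hz _].
  apply: submx_sub; first exact: submx_sub.
  by apply: submx_trans hz (Fmono _); ilia.
rewrite def; apply: addmx_sub; last apply: addmx_sub.
- apply: submx_trans hx _; apply: (sub_Isum delJ_supp); ilia.
- apply: submx_trans (submx_trans hz IHp) _; apply: (Isum_mono delJ_supp) => c d; ilia.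
- apply: submx_trans (submx_trans wF (IH _)) _; apply: (Isum_mono delJ_supp) => c d; ilia.
Qed.

Lemma delJ_W_eq k : (W k == Isum N (fun c d => c + d <= k)%R delJ)%MS.
Proof.
apply/andP; split; last first.
  by apply: Isum_sub => c d h; apply: submx_trans (delJ_W _ _) (Wmono h).
have : (W k <= F a' :&: W k)%MS.
  by rewrite sub_capmx submx_refl andbT (submx_trans (submx1 _) (F1 _)).
move/submx_trans/(_ (delJ_span_FW _ _))/submx_trans; apply.
by apply: (Isum_mono delJ_supp) => c d /andP[].
Qed.

Lemma delJ_F_eq p : (F p == Isum N (fun c _ => p <= c)%R delJ)%MS.
Proof.
apply/andP; split; last first.
  by apply: Isum_sub => c d h; apply: submx_trans (delJ_F _ _) (Fmono h).
have : (F p <= F p :&: W b)%MS.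
  by rewrite sub_capmx submx_refl (submx_trans (submx1 _) (W1 _)).
move/submx_trans/(_ (delJ_span_FW _ _))/submx_trans; apply.
by apply: (Isum_mono delJ_supp) => c d /andP[].
Qed.

Lemma delJ_bigraded : bigraded N delJ.
Proof.
split; first exact: delJ_supp.
  (* The bound 2N dominates the weight of every cell, and b makes W the whole space. *)
  have -> : csum N (fun _ _ => true) delJ =
            csum N (fun c d => c + d <= Num.max b (N%:Z + N%:Z)) delJ.
    by apply: csum_eq => c d /delJ_rank_range; ilia.
  rewrite csum_delJ; apply/eqP; rewrite -[_ == _]/(row_full _) -sub1mx W1 //; ilia.
have /andP[+ _] := delJ_W_eq b; move/(submx_trans (W1 (lexx _)))/submx_trans; apply.
exact: (Isum_mono delJ_supp).
Qed.

End Opposed.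

(** * Conjugation *)

Section Conj.
Variables (R : realType) (n : nat).
Local Notation C := R[i].
Local Notation mx := 'M[C]_n.
Local Notation rv := 'rV[C]_n.

Lemma conjmK m : involutive (@conjm R n m).
Proof. by move=> A; apply/matrixP => j k; rewrite !mxE conjCK. Qed.

Lemma conjmD m (A B : 'M[C]_(m, n)) : conjm (A + B) = conjm A + conjm B.
Proof. exact: map_mxD. Qed.

Lemma conjmB m (A B : 'M[C]_(m, n)) : conjm (A - B) = conjm A - conjm B.
Proof. exact: map_mxB. Qed.

Lemma conjm0 m : conjm (0 : 'M[C]_(m, n)) = 0.
Proof. exact: map_mx0. Qed.

Lemma conjmM m (A : 'M[C]_(m, n)) (B : mx) : conjm (A *m B) = conjm A *m conjm B.
Proof. exact: map_mxM. Qed.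

Lemma conjm_sub m1 m2 (A : 'M[C]_(m1, n)) (B : 'M[C]_(m2, n)) :
  (conjm A <= conjm B)%MS = (A <= B)%MS.
Proof. exact: map_submx. Qed.

Lemma conjm_subC m1 m2 (A : 'M[C]_(m1, n)) (B : 'M[C]_(m2, n)) :
  (conjm A <= B)%MS = (A <= conjm B)%MS.
Proof. by rewrite -conjm_sub conjmK. Qed.

Lemma conjm_cap (A B : mx) : (conjm (A :&: B)%MS :=: conjm A :&: conjm B)%MS.
Proof. exact: map_capmx. Qed.

Lemma conjm_adds (A B : mx) : (conjm (A + B)%MS :=: conjm A + conjm B)%MS.
Proof. exact: map_addsmx. Qed.

Lemma conjm_cW (W : int -> 'M[rat]_n) k : conjm (cW R W k) = cW R W k.
Proof. by apply/matrixP => j l; rewrite !mxE fmorph_rat. Qed.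

Lemma conjm_cQ (Q : int -> 'M[rat]_n) k : conjm (cQ R Q k) = cQ R Q k.
Proof. by apply/matrixP => j l; rewrite !mxE fmorph_rat. Qed.

End Conj.

(** * Conjugates of the cells of Deligne's formula *)

Section ConjOpposed.
Variables (R : realType) (n : nat).
Local Notation C := R[i].
Local Notation mx := 'M[C]_n.
Local Notation rv := 'rV[C]_n.
Variables (W F : int -> mx) (a b a' b' : int) (N : nat).
Local Notation G := (fun p => conjm (F p)).
Hypothesis opp : opposed W F G a b a' b' N.
Hypothesis conjW : forall k, conjm (W k) = W k.
Let W0 := opp_W0 opp.
Let Wmono := opp_Wmono opp.
Let Gmono := opp_Gmono opp.
Local Notation T := (tail W G a).
Local Notation J := (delJ W F G a).
Let Jgr := delJ_bigraded opp.
Let Jsupp := delJ_supp opp.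

Lemma sub_delJ_W m (v : 'M[C]_(m, n)) k :
  (v <= W k)%MS = (v <= Isum N (fun c d => c + d <= k)%R J)%MS.
Proof. by have /eqmxP -> := delJ_W_eq opp k. Qed.

(** Leading-term argument: the weight l part of y lies in F^s and agrees with u modulo W_{l-1}; as s
    + r = l + 1, opposedness kills it in Gr_l. *)
Lemma Isum_delJ_top (P : int -> int -> bool) (r s l : int) (y u : rv) : s + r = l + 1 ->
  (forall c d, P c d -> (c + d <= l) && ((c + d == l) ==> (s <= c))) ->
  (y <= Isum N P J)%MS -> (u <= G r :&: W l)%MS -> ((y - u)%R <= W (l - 1))%MS ->
  (y <= W (l - 1))%MS.
Proof.
move=> hsr hP hy hu hyu.
have : (y <= Isum N (fun c d => c + d <= l - 1)%R J +
             Isum N (fun c d => (s <= c) && (c + d <= l))%R J)%MS.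
  by apply: (Isum_split Jgr _ hy) => c d /hP; ilia.
case/sub_addsP=> y1 [y2 []]; rewrite -sub_delJ_W => hy1 hy2 def.
suff : (y2 <= W (l - 1))%MS by rewrite def; apply: addmx_sub.
apply: (opposed_cap opp hsr _ hu).
  apply: submx_trans hy2 _; apply: Isum_sub => c d /andP[sc hcd].
  rewrite sub_capmx; apply/andP; split.
    exact: submx_trans (delJ_F _ _ _ _ _ _) (opp_Fmono opp sc).
  exact: submx_trans (delJ_W _ _ _ _ _ _) (Wmono hcd).
have -> : y2 - u = (y - u) - y1 by rewrite def; zmod.
exact: submx_sub.
Qed.

(** Split off the weight l cells with c < q. They have d >= r, hence lie in T(r,l), so the rest y2
    is still in the tail; its weight l cells have c >= q and vanish by [Isum_delJ_top]. Thus y2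
    falls into the tail T(r-1,l-1), one weight lower. *)
Lemma tail_Isum_delJ (p q l r : int) (y : rv) : r + q = l + 1 ->
  (y <= Isum N (fun c d => (d < p) && (c + d <= l))%R J)%MS -> (y <= T r l)%MS ->
  (y <= Isum N (fun c d => (c < q) && (d < p))%R J)%MS.
Proof.
move: l r y; apply: (@int_up_ind _ a) => [l la|l IH] r y hrq hy hT.
  by move: hT; rewrite tail_0 // submx0 => /eqP->; rewrite sub0mx.
have : (y <= Isum N (fun c d => [&& c < q, d < p & c + d == l])%R J +
  Isum N (fun c d => [&& d < p, c + d <= l & (c + d == l) ==> (q <= c)])%R J)%MS.
  by apply: (Isum_split Jgr _ hy) => c d; ilia.
case/sub_addsP=> y1 [y2 [hy1 hy2 def]].
have y1T : (y1 <= T r l)%MS.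
  apply: submx_trans hy1 _; apply: Isum_sub => c d /and3P[cq dp /eqP cdl].
  apply: submx_trans (delJ_A _ _ _ _ _ _) _; rewrite cdl addsmx_sub.
  apply/andP; split.
    by apply: submx_trans (sub_tail _ W0 Wmono _ _) (tail_le W0 Wmono Gmono _ _); ilia.
  by apply: tail_le => //; ilia.
have : (y2 <= T r l)%MS.
  by have -> : y2 = y - y1; [rewrite def; zmod | exact: submx_sub].
rewrite tailE // => /sub_addsP[u [t [hu ht def2]]].
have tW := submx_trans ht (tail_W _ _ Wmono _ _).
have y2W : (y2 <= W (l - 1))%MS.
  apply: (@Isum_delJ_top _ r q _ _ u _ _ hy2 hu); [ilia | by move=> c d; ilia|].
  by have -> : y2 - u = t; [rewrite def2; zmod|].
have uW : (u <= W (l - 1))%MS.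
  by have -> : u = y2 - t; [rewrite def2; zmod | exact: submx_sub].
rewrite def; apply: addmx_sub.
  by apply: submx_trans hy1 _; apply: (Isum_mono Jsupp) => c d; ilia.
apply: (IH (r - 1)); first by ilia.
  move: y2W; rewrite sub_delJ_W => y2W.
  by apply: (Isum_cap Jgr _ hy2 y2W) => c d; ilia.
rewrite def2; apply: addmx_sub ht.
apply: submx_trans (sub_tail _ W0 Wmono _ _); rewrite sub_capmx uW andbT.
by apply: submx_trans (submx_trans hu (capmxSl _ _)) (Gmono _); ilia.
Qed.

Lemma conj_delJ_sub (p q : int) :
  (conjm (J p q) <= J q p + Isum N (fun c d => (c < q) && (d < p))%R J)%MS.
Proof.
rewrite conjm_subC; apply/rV_subP => v hv; rewrite -conjm_subC.
pose k := p + q.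
have vF := submx_trans hv (delJ_F _ _ _ _ _ _).
have vW : (v <= W k)%MS := submx_trans hv (delJ_W _ _ _ _ _ _).
have /sub_addsP[y [t [hy ht def]]] : (v <= delA W G a q k)%MS :=
  submx_trans hv (delJ_A _ _ _ _ _ _).
have hy' : (conjm y <= F q :&: W k)%MS.
  by move: hy; rewrite !sub_capmx !conjm_subC conjW.
(* The conjugate of the j-th term of the tail is F^{q-1-j} /\ W_{k-2-j}; its cells have c >= q-1-j
   and c + d <= k-2-j, whence d <= p-1. *)
have ht' : (conjm t <= Isum N (fun c d => (d < p) && (c + d <= k))%R J)%MS.
  rewrite conjm_subC; apply: submx_trans ht _; apply: tail_ind => j.
  rewrite -conjm_subC conjm_cap conjmK conjW.
  apply: submx_trans (delJ_span_FW opp _ _) _; apply: (Isum_mono Jsupp) => c d.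
  by rewrite /k; ilia.
have : (conjm y <= J q p + Isum N (fun c d => (d < p) && (c + d <= k))%R J)%MS.
  apply: submx_trans (submx_trans hy' (delJ_span_FW opp _ _)) _.
  apply: Isum_sub => c d hcd.
  have [/andP[/eqP-> /eqP->]|h] := boolP ((c == q) && (d == p)); first exact: addsmxSl.
  apply: submx_trans (addsmxSr _ _); apply: (sub_Isum Jsupp).
  by move: hcd h; rewrite /k; ilia.
case/sub_addsP=> x [z0 [hx hz0 defy]].
pose z := z0 + conjm t.
have hz : (z <= Isum N (fun c d => (d < p) && (c + d <= k))%R J)%MS by apply: addmx_sub.
have defv : conjm v = x + z by rewrite def conjmD defy /z; zmod.
rewrite defv; apply: (adds_sub hx).
(* Second description of z: both conj v and x lie in [delA] for the index p. Played against the
   bound d < p on its cells, it forces z into low weight. *)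
have : (z <= delA W G a p k)%MS.
  have -> : z = conjm v - x by rewrite defv; zmod.
  apply: submx_sub.
    apply: submx_trans (addsmxSl _ _).
    by rewrite sub_capmx conjm_sub vF conjm_subC conjW.
  by have := submx_trans hx (delJ_A _ _ _ _ _ _); rewrite /k addrC.
case/sub_addsP=> u [t' [hu ht'' defz]].
have tW := submx_trans ht'' (tail_W _ _ Wmono _ _).
have e : z - u = t' by rewrite defz; zmod.
have e' : u = z - t' by rewrite defz; zmod.
(* In weight k, d < p forces c >= q+1, and in weight k-1 it forces c >= q: the leading terms vanish
   twice and z drops to W_{k-2}. *)
have zW : (z <= W (k - 1))%MS.
  apply: (@Isum_delJ_top _ p (q + 1) _ _ u _ _ hz hu); [rewrite /k; ilia|..].
    by move=> c d; rewrite /k; ilia.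
  by rewrite e; apply: submx_trans tW (Wmono _); ilia.
have uW : (u <= W (k - 1))%MS.
  by rewrite e'; apply: submx_sub zW (submx_trans tW (Wmono _)); ilia.
have uG := submx_trans hu (capmxSl _ _).
have e2 : k - 1 - 1 = k - 2 by ilia.
have hz1 : (z <= Isum N (fun c d => (d < p) && (c + d <= k - 1))%R J)%MS.
  move: zW; rewrite sub_delJ_W => zW.
  by apply: (Isum_cap Jgr _ hz zW) => c d; ilia.
have zW2 : (z <= W (k - 2))%MS.
  rewrite -e2; apply: (@Isum_delJ_top _ p q _ _ u _ _ hz1); [rewrite /k; ilia|..].
  - by move=> c d; rewrite /k; ilia.
  - by rewrite sub_capmx uG.
  - by rewrite e e2.
have uW2 : (u <= W (k - 2))%MS by rewrite e'; apply: submx_sub.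
apply: (@tail_Isum_delJ p q (k - 2) (p - 1)); first by rewrite /k; ilia.
  move: zW2; rewrite sub_delJ_W => zW2.
  by apply: (Isum_cap Jgr _ hz zW2) => c d; ilia.
rewrite defz; apply: addmx_sub ht''.
apply: submx_trans (sub_tail _ W0 Wmono _ _); rewrite sub_capmx uW2 andbT.
by apply: submx_trans uG (Gmono _); ilia.
Qed.

(** The reverse inclusion is the conjugate of the first with p and q exchanged; the indeterminacy
    follows, since conj J^{c,d} with c < p, d < q only involves J^{d,c} and cells below it in both
    indices. *)
Lemma conj_delJ (p q : int) :
  (conjm (J p q) + Isum N (fun r s => (r < q) && (s < p))%R J
   == J q p + Isum N (fun r s => (r < q) && (s < p))%R J)%MS.
Proof.
apply/andP; split; first by rewrite addsmx_sub conj_delJ_sub addsmxSr.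
rewrite addsmx_sub addsmxSr andbT -[J q p]conjmK conjm_subC.
apply: submx_trans (conj_delJ_sub q p) _.
rewrite conjm_adds conjmK addsmxS // -conjm_subC conjm_subC.
apply: Isum_sub => c d /andP[cp dq]; rewrite -conjm_subC.
apply: submx_trans (conj_delJ_sub c d) _; rewrite addsmx_sub; apply/andP; split.
  by apply: (sub_Isum Jsupp); rewrite dq.
by apply: (Isum_mono Jsupp) => r s; ilia.
Qed.

End ConjOpposed.

(** * The Deligne bigrading *)

Section DeligneSplitting.
Variables (R : realType) (n : nat).
Local Notation C := R[i].
Local Notation mx := 'M[C]_n.
Local Notation rv := 'rV[C]_n.
Implicit Types (W Q : int -> 'M[rat]_n) (F : int -> mx) (I : int -> int -> mx).

Lemma incr_mono (K : fieldType) (X : int -> 'M[K]_n) :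
  (forall k, (X k <= X (k + 1)%R)%MS) -> forall j k : int, j <= k -> (X j <= X k)%MS.
Proof.
move=> h j k jk; have -> : k = j + `|k - j|%N by lia.
elim: `|k - j|%N => [|m IH]; first by rewrite addr0.
apply: submx_trans IH _; have -> : j + m.+1%:Z = j + m%:Z + 1 by lia.
exact: h.
Qed.

Lemma decr_mono (K : fieldType) (X : int -> 'M[K]_n) :
  (forall k, (X (k + 1)%R <= X k)%MS) -> forall j k : int, j <= k -> (X k <= X j)%MS.
Proof.
move=> h j k jk; rewrite -[k]opprK -[j]opprK.
apply: (@incr_mono K (fun i => X (- i))) => [i|]; last by lia.
by have := h (- (i + 1)); have -> : - (i + 1) + 1 = - i by lia.
Qed.

Lemma cW_mono W : incr_filtration W -> forall j k : int, j <= k -> (cW R W j <= cW R W k)%MS.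
Proof. by move=> [hW _] j k jk; rewrite map_submx; apply: incr_mono. Qed.

(** Stated for all large [N], so that two filtrations can later be given bigradings over a common
    window. *)
Lemma MHS_opposed W F : incr_filtration W -> decr_filtration F -> is_MHS W F ->
  exists a b a' b' N0, forall N, (N0 <= N)%N ->
    opposed (cW R W) F (fun p => conjm (F p)) a b a' b' N.
Proof.
move=> hW hF hM; have [_ [a [b hab]]] := hW; have [hFd [a' [b' hab']]] := hF.
exists a, b, a', b', (`|b'| + `|a - b'|)%N => N hN.
have F0 (p : int) : b' <= p -> F p = 0 by move=> /((hab' p).2)/eqmx0P.
have FM (p q : int) : p <= q -> (F q <= F p)%MS by apply: decr_mono.
split=> //; try by lia.
- by move=> k /((hab k).1)/eqmx0P; rewrite /cW => ->; rewrite map_mx0.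
- by move=> k /((hab k).2); rewrite -(map_submx (@ratr C)) map_mx1.
- by move=> p /((hab' p).1).
- by move=> p /F0->; rewrite conjm0.
- exact: cW_mono.
- by move=> p q /FM; rewrite conjm_sub.
- move=> p q k hpq; have [/eqmxP h _] := hM k p.
  have e : k - p + 1 = q by lia.
  rewrite -h e /FGr /cFGr !addsmx_sub addsmxSr !andbT; apply/andP; split.
    by apply: submx_trans (addsmxSl _ _); exact: addsmxSl.
  apply: submx_trans (addsmxSl _ _); apply: submx_trans (addsmxSr _ _).
  by rewrite conjm_cap conjm_cW.
- move=> p q k x y hpq hx hy hxy; have [_ /eqmxP <-] := hM k p.
  have -> : k - p + 1 = q by lia.
  rewrite sub_capmx; apply/andP; split; first exact: submx_trans hx (addsmxSl _ _).
  rewrite -[x](addrNK y) addrC; apply: adds_sub hxy.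
  by rewrite conjm_cap conjm_cW.
Qed.

Lemma deligne_bigraded W F N I : deligne W F N I -> bigraded N I.
Proof.
move=> [h0 [hn [h1 _]]]; split=> //.
by rewrite -[RHS]hn big_zrange2.
Qed.

Lemma delJ_deligne W F a b a' b' N :
  opposed (cW R W) F (fun p => conjm (F p)) a b a' b' N ->
  deligne W F N (delJ (cW R W) F (fun p => conjm (F p)) a).
Proof.
move=> opp; have [h0 hn h1] := delJ_bigraded opp.
split=> //; split; first by rewrite big_zrange2.
split=> //; split; first exact: (delJ_F_eq opp).
split; first exact: (delJ_W_eq opp).
by move=> p q; apply: (conj_delJ opp) => k; exact: conjm_cW.
Qed.

Lemma deligne_F W F N I a b : deligne W F N I -> (I a b <= F a)%MS.
Proof.
move=> h; have [h0 [_ [_ [/(_ a)/eqmxP-> _]]]] := h.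
by apply: (sub_Isum h0).
Qed.

Lemma deligne_W W F N I a b : deligne W F N I -> (I a b <= cW R W (a + b))%MS.
Proof.
move=> h; have [h0 [_ [_ [_ [/(_ (a + b))/eqmxP-> _]]]]] := h.
by apply: (sub_Isum h0).
Qed.

Lemma deligne_conj W F N I p q : deligne W F N I ->
  (conjm (I p q) <= I q p + Isum N (fun r s => (r < q) && (s < p))%R I)%MS.
Proof.
by move=> [_ [_ [_ [_ [_ /(_ p q)/eqmxP <-]]]]]; exact: addsmxSl.
Qed.

Lemma deligne_conj' W F N I p q : deligne W F N I ->
  (I p q <= conjm (I q p) + Isum N (fun r s => (r < p) && (s < q))%R I)%MS.
Proof.
by move=> [_ [_ [_ [_ [_ /(_ q p)/eqmxP ->]]]]]; exact: addsmxSl.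
Qed.

(** Induction on the bound l of the weight. The conjugation condition puts I^{r,s} in conj I^{s,r},
    which lies in G^s /\ W_{r+s}, plus cells (c,d) with c < r and d < s; for these [tail_le] only
    asks c <= r. *)
Lemma deligne_tail W F N I a b a' b' N' : deligne W F N I ->
  opposed (cW R W) F (fun p => conjm (F p)) a b a' b' N' ->
  forall l (r s : int), r + s <= l ->
    (I r s <= tail (cW R W) (fun p => conjm (F p)) a s (r + s))%MS.
Proof.
move=> hI opp; have W0 := opp_W0 opp; have Wm := opp_Wmono opp; have Gm := opp_Gmono opp.
apply: (@int_up_ind _ a) => [l la|l IH] r s hrs.
  apply: submx_trans (deligne_W r s hI) _.
  by rewrite W0 ?sub0mx //; lia.
apply: submx_trans (deligne_conj' _ _ hI) _; rewrite addsmx_sub; apply/andP; split.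
  apply: submx_trans (sub_tail _ W0 Wm _ _); rewrite sub_capmx conjm_sub (deligne_F _ _ hI).
  by rewrite conjm_subC conjm_cW addrC (deligne_W _ _ hI).
apply: Isum_sub => c d hcd; apply: submx_trans (IH c d _) _; first by ilia.
by apply: tail_le => //; ilia.
Qed.

(** Once I^{r,s} is contained in J^{r,s} for all r, s, take v in J^{p,q}, decompose it along I and
    project onto J^{p,q}: only its I^{p,q} component survives, so v equals it. *)
Lemma deligne_delJ W F N I a b a' b' N' : deligne W F N I ->
  opposed (cW R W) F (fun p => conjm (F p)) a b a' b' N' ->
  forall p q, (I p q :=: delJ (cW R W) F (fun p => conjm (F p)) a p q)%MS.
Proof.
move=> hI opp p q; set J := delJ _ _ _ _.
have le r s : (I r s <= J r s)%MS.
  rewrite /J /delJ !sub_capmx (deligne_F _ _ hI) (deligne_W _ _ hI) /=.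
  apply: submx_trans (deligne_conj' _ _ hI) _; rewrite /delA addsmxS //.
    rewrite sub_capmx conjm_sub (deligne_F _ _ hI).
    by rewrite conjm_subC conjm_cW addrC (deligne_W _ _ hI).
  apply: Isum_sub => c d hcd; apply: submx_trans (deligne_tail hI opp (lexx (c + d))) _.
  by apply: (tail_le (opp_W0 opp) (opp_Wmono opp) (opp_Gmono opp)); ilia.
apply/eqmxP/andP; split=> //; apply/rV_subP => v hv.
have Ig := deligne_bigraded hI; have Jg := delJ_bigraded opp.
suff -> : v = v *m bproj N I p q by apply: bproj_sub.
have vp : v *m bproj N' J p q = v by apply: bproj_id.
rewrite -{1}vp {1}(bproj_decomp Ig v) mulmx_suml.
have e x : v *m bproj N I x.1 x.2 *m bproj N' J p q =
    if x == (p, q) then v *m bproj N I p q else 0.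
  have := submx_trans (bproj_sub N I x.1 x.2 v) (le _ _).
  case: x => c d /= hx; case: ifP => [/eqP[ec ed]|h].
    by rewrite -ec -ed in hx *; apply: bproj_id.
  by apply: (bproj_0 _ hx) => //; rewrite -xpair_eqE h.
under eq_bigr do rewrite e.
have [hpq|npq] := boolP ((p, q) \in zrange2 N).
  by rewrite (bigD1_seq (p, q)) ?uniq_zrange2 //= eqxx big1 ?addr0 // => x /negbTE ->.
rewrite [RHS](_ : _ = 0).
  by rewrite big_seq big1 // => x hx; case: eqP => // ex; rewrite -ex hx in npq.
move: npq; rewrite mem_zrange2 => /(bigraded_supp Ig)/eqmx0P h0.
by apply/eqP; rewrite -submx0 -h0; apply: bproj_sub.
Qed.

Lemma deligne_exists W F : incr_filtration W -> decr_filtration F -> is_MHS W F ->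
  exists N0, forall N, (N0 <= N)%N -> exists I, deligne W F N I.
Proof.
move=> hW hF hM; have [a [b [a' [b' [N0 h]]]]] := MHS_opposed hW hF hM.
by exists N0 => N /h opp; eexists; apply: delJ_deligne opp.
Qed.

Lemma deligne_unique W F N N' I I' : incr_filtration W -> decr_filtration F -> is_MHS W F ->
  deligne W F N I -> deligne W F N' I' -> forall p q, (I p q :=: I' p q)%MS.
Proof.
move=> hW hF hM hI hI' p q; have [a [b [a' [b' [N0 /(_ N0 (leqnn _)) opp]]]]] := MHS_opposed hW hF hM.
apply: eqmx_trans (deligne_delJ hI opp p q) _; apply/eqmx_sym.
exact: (deligne_delJ hI' opp p q).
Qed.

End DeligneSplitting.

(** * The action of G *)

Section Forms.
Variables (R : realType) (n : nat).
Local Notation C := R[i].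
Local Notation mx := 'M[C]_n.
Local Notation rv := 'rV[C]_n.
Implicit Types (W Q : int -> 'M[rat]_n) (F : int -> mx) (I : int -> int -> mx).
Implicit Types (u v w x y : rv) (g : mx).

Lemma bilDl (B : mx) u v w : bil B (u + v) w = bil B u w + bil B v w.
Proof. by rewrite /bil !mulmxDl mxE. Qed.

Lemma bilDr (B : mx) u v w : bil B w (u + v) = bil B w u + bil B w v.
Proof. by rewrite /bil linearD mulmxDr mxE. Qed.

Lemma bil0r (B : mx) u : bil B u 0 = 0.
Proof. by rewrite /bil linear0 mulmx0 mxE. Qed.

Lemma bil0l (B : mx) u : bil B 0 u = 0.
Proof. by rewrite /bil !mul0mx mxE. Qed.

Lemma bil_suml (B : mx) (T : Type) (r : seq T) (f : T -> rv) w :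
  bil B (\sum_(x <- r) f x) w = \sum_(x <- r) bil B (f x) w.
Proof. exact: (big_morph _ (fun u v => bilDl B u v w) (bil0l B w)). Qed.

Lemma conj_bil Q k u v : (bil (cQ R Q k) u v)^* = bil (cQ R Q k) (conjm u) (conjm v).
Proof.
rewrite /bil -[in RHS](conjm_cQ R Q k) -conjmM.
have -> : (conjm v)^T = map_mx Num.conj v^T by rewrite map_trmx.
by rewrite /conjm -map_mxM [RHS]mxE.
Qed.

Lemma bil_sym W Q k u v : graded_forms W Q ->
  bil (cQ R Q k) v u = (-1) ^ k * bil (cQ R Q k) u v.
Proof.
move=> /(_ k)[hQ _]; rewrite /bil.
have -> : (v *m cQ R Q k *m u^T) 0 0 = ((v *m cQ R Q k *m u^T)^T) 0 0 by rewrite [RHS]mxE.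
rewrite !trmx_mul trmxK.
have -> : (cQ R Q k)^T = (-1) ^ k *: cQ R Q k.
  rewrite /cQ map_trmx hQ map_mxZ; congr (_ *: _).
  by rewrite rmorphXz ?rmorphN1 // unitrN unitr1.
by rewrite -scalemxAl -scalemxAr mxE mulmxA.
Qed.

(** [graded_forms] speaks of rational vectors only; the radical condition is read as the vanishing
    of a rational matrix, which survives extension of scalars. *)
Lemma bil_rad W Q k u w : incr_filtration W -> graded_forms W Q ->
  (u <= cW R W k)%MS -> (w <= cW R W (k - 1))%MS -> bil (cQ R Q k) w u = 0.
Proof.
move=> hW /(_ k)[_ hQ] /submxP[y ->] /submxP[x ->].
suff h : W (k - 1) *m Q k *m (W k)^T = 0.
  rewrite /bil trmx_mul !mulmxA -(mulmxA x) -(mulmxA x) /cW /cQ.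
  by rewrite map_trmx -!map_mxM h map_mx0 mulmx0 mul0mx mxE.
have Wk : (W (k - 1) <= W k)%MS by case: hW => hW _; apply: incr_mono => //; lia.
apply/row_matrixP => i; apply/rowP => j; rewrite row0 !row_mul.
have hi : (row i (W (k - 1)) <= W (k - 1))%MS by apply: row_sub.
have := (hQ _ (submx_trans hi Wk)).2 hi _ (row_sub j (W k)).
move/matrixP/(_ 0 0); rewrite [X in X = _]mxE [X in _ = X]mxE => h.
rewrite [X in X = _]mxE [X in _ = X]mxE -[RHS]h; apply: eq_bigr => l _.
by congr (_ * _); rewrite !mxE.
Qed.

Lemma bil_rad' W Q k u w : incr_filtration W -> graded_forms W Q ->
  (u <= cW R W k)%MS -> (w <= cW R W (k - 1))%MS -> bil (cQ R Q k) u w = 0.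
Proof.
by move=> hW hQ hu hw; rewrite (bil_sym _ _ _ hQ) (bil_rad hW hQ hu hw) mulr0.
Qed.

End Forms.

Section Action.
Variables (R : realType) (n : nat).
Local Notation C := R[i].
Local Notation mx := 'M[C]_n.
Local Notation rv := 'rV[C]_n.
Variables (W Q : int -> 'M[rat]_n) (g : mx).
Hypothesis hW : incr_filtration W.
Hypothesis hQ : graded_forms W Q.
Hypothesis hg : inG W Q g.
Implicit Types (u v w x y : rv) (F : int -> mx).

Lemma inG_unit : g \in unitmx. Proof. by case: hg. Qed.

Lemma inG_W k : (cW R W k *m g :=: cW R W k)%MS.
Proof. by apply/eqmxP; case: hg => _ [/(_ k)]. Qed.

Lemma inG_subW m (v : 'M[C]_(m, n)) k : (v *m g <= cW R W k)%MS = (v <= cW R W k)%MS.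
Proof. by rewrite -(inG_W k) subMunit ?inG_unit. Qed.

Lemma inG_real v k : (v <= cW R W k)%MS ->
  ((conjm (v *m g) - conjm v *m g)%R <= cW R W (k - 1))%MS.
Proof. by case: hg => _ [_ [h _]]; apply: h. Qed.

Lemma inG_bil k u v : (u <= cW R W k)%MS -> (v <= cW R W k)%MS ->
  bil (cQ R Q k) (u *m g) (v *m g) = bil (cQ R Q k) u v.
Proof. by case: hg => _ [_ [_ h]]; apply: h. Qed.

(** On W_k, g commutes with conjugation up to W_{k-1}, which is in the radical of Q_k. *)
Lemma inG_bil_conj k u v : (u <= cW R W k)%MS -> (v <= cW R W k)%MS ->
  bil (cQ R Q k) (u *m g) (conjm (v *m g)) = bil (cQ R Q k) u (conjm v).
Proof.
move=> hu hv; have -> : conjm (v *m g) = conjm v *m g + (conjm (v *m g) - conjm v *m g).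
  by zmod.
rewrite bilDr [X in _ + X](bil_rad' (W := W)) ?inG_real ?inG_subW // addr0 inG_bil //.
by rewrite conjm_subC conjm_cW.
Qed.

Lemma act_cap F p k : (act g F p :&: cW R W k :=: (F p :&: cW R W k) *m g)%MS.
Proof.
apply: eqmx_trans (cap_eqmx (eqmx_refl _) (eqmx_sym (inG_W k))) (eqmx_sym _).
exact: capMunit inG_unit.
Qed.

Lemma act_FGr F p k : (FGr W (act g F) p k :=: FGr W F p k *m g)%MS.
Proof.
rewrite /FGr; apply: eqmx_trans (eqmx_sym (addsmxMr _ _ _)).
exact: adds_eqmx (act_cap _ _ _) (eqmx_sym (inG_W _)).
Qed.

Lemma act_cFGr F p k : (cFGr W (act g F) p k :=: cFGr W F p k *m g)%MS.
Proof.
rewrite /cFGr; apply: eqmx_trans (eqmx_sym (addsmxMr _ _ _)).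
set A := (F p :&: cW R W k)%MS.
have rx x : (x <= A)%MS -> ((conjm (x *m g) - conjm x *m g)%R <= cW R W (k - 1))%MS.
  by move=> /submx_trans/(_ (capmxSr _ _)); exact: inG_real.
apply/eqmxP/andP; split; rewrite addsmx_sub; apply/andP; split.
- rewrite conjm_subC act_cap -/A; apply/rV_subP => _ /submxP[y ->]; rewrite mulmxA.
  rewrite -conjm_subC; have -> : conjm (y *m A *m g) = conjm (y *m A) *m g +
    (conjm (y *m A *m g) - conjm (y *m A) *m g) by zmod.
  apply: adds_sub; first by rewrite submxMr // conjm_sub submxMl.
  by rewrite inG_W rx // submxMl.
- by apply: submx_trans (addsmxSr _ _); rewrite inG_W.
- apply/rV_subP => _ /submxP[y ->]; rewrite mulmxA; set x := conjm y *m A.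
  have -> : y *m conjm A = conjm x by rewrite conjmM conjmK.
  have -> : conjm x *m g = conjm (x *m g) - (conjm (x *m g) - conjm x *m g) by zmod.
  apply: submx_sub.
    apply: submx_trans (addsmxSl _ _); rewrite conjm_sub act_cap submxMr //.
    exact: submxMl.
  by apply: submx_trans (addsmxSr _ _); rewrite rx // submxMl.
- by rewrite inG_W addsmxSr.
Qed.

Lemma inG_inM f F : inM W Q f F -> inM W Q f (act g F).
Proof.
have ug := inG_unit; have fg : row_free g by rewrite row_free_unit.
move=> [[hF [a [b hab]]] [hf [hM hP]]]; split; last split; last split.
- split=> [p|]; first exact: submxMr.
  exists a, b => p; split=> [/((hab p).1) h|/((hab p).2)/eqmx0P h].
    by rewrite /act subMunitP // submx_full // -sub1mx.
  by rewrite /act h mul0mx !submx_refl.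
- by move=> p; rewrite mxrankMfree.
- move=> k p; have [/eqmxP h1 /eqmxP h2] := hM k p; split; apply/eqmxP.
    apply: eqmx_trans (adds_eqmx (act_FGr _ _ _) (act_cFGr _ _ _)) _.
    apply: eqmx_trans (eqmx_sym (addsmxMr _ _ _)) _.
    exact: eqmx_trans (eqmxMr _ h1) (inG_W _).
  apply: eqmx_trans (cap_eqmx (act_FGr _ _ _) (act_cFGr _ _ _)) _.
  apply: eqmx_trans (eqmx_sym (capMunit _ _ ug)) _.
  exact: eqmx_trans (eqmxMr _ h2) (inG_W _).
- move=> k p q hpq; have [h1 h2] := hP k p q hpq; split=> [u v|v].
    rewrite !act_cap !subMunitP // => hu hv.
    rewrite -[u](mulmxKV ug) -[v](mulmxKV ug) inG_bil ?h1 //.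
      exact: submx_trans hu (capmxSr _ _).
    exact: submx_trans hv (capmxSr _ _).
  rewrite sub_capmx act_FGr act_cFGr !subMunitP // -sub_capmx -(inG_W (k - 1)) subMunitP // => hv nv.
  rewrite -[v](mulmxKV ug) inG_bil_conj ?h2 //;
    apply: submx_trans hv (submx_trans (capmxSl _ _) _);
    by rewrite addsmx_sub capmxSr (cW_mono _ hW) //; ilia.
Qed.

End Action.

(** * Isometry *)

Section Herm.
Variables (R : realType) (n : nat).
Local Notation C := R[i].
Local Notation mx := 'M[C]_n.
Local Notation rv := 'rV[C]_n.
Implicit Types (W Q : int -> 'M[rat]_n) (F : int -> mx) (I : int -> int -> mx).
Implicit Types (u v w x y z : rv) (g H : mx).

Lemma hermE H u v : herm H u v = bil H u (conjm v). Proof. by []. Qed.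

Lemma hermDr H u v w : herm H w (u + v) = herm H w u + herm H w v.
Proof. by rewrite !hermE conjmD bilDr. Qed.

Lemma herm0r H u : herm H u 0 = 0.
Proof. by rewrite hermE conjm0 bil0r. Qed.

Lemma herm_suml H (T : Type) (r : seq T) (f : T -> rv) w :
  herm H (\sum_(x <- r) f x) w = \sum_(x <- r) herm H (f x) w.
Proof. exact: bil_suml. Qed.

Lemma herm_sumr H (T : Type) (r : seq T) (f : T -> rv) w :
  herm H w (\sum_(x <- r) f x) = \sum_(x <- r) herm H w (f x).
Proof. exact: (big_morph _ (fun u v => hermDr H u v w) (herm0r H w)). Qed.

Lemma hermBr H u v w : herm H w (u - v) = herm H w u - herm H w v.
Proof.
by apply/eqP; rewrite eq_sym subr_eq -hermDr addrNK.
Qed.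

Lemma deligne_subW_0 W F N I p q v k : deligne W F N I ->
  (v <= I p q)%MS -> (v <= cW R W k)%MS -> k < p + q -> v = 0.
Proof.
move=> hI hv; have gI := deligne_bigraded hI.
case: (hI) => [_ [_ [_ [_ [/(_ k)/eqmxP-> _]]]]] hW hk.
rewrite -(bproj_id gI hv); apply: (proj1 (sub_IsumP gI _ _) hW).
by rewrite -ltNge.
Qed.

Lemma deligne_pos W Q F N I p q v : incr_filtration W ->
  graded_polarized W Q F -> deligne W F N I ->
  (v <= I p q)%MS -> v != 0 -> 0 < 'i ^ (p - q) * bil (cQ R Q (p + q)) v (conjm v).
Proof.
move=> hW hP hI hv v0; have [_ h] := hP (p + q) p q erefl; apply: h.
  have IW r s := deligne_W r s hI; have IF r s := deligne_F r s hI.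
  rewrite sub_capmx; apply/andP; split.
    apply: submx_trans (addsmxSl _ _); apply: submx_trans hv _.
    by rewrite sub_capmx IF IW.
  apply: submx_trans hv (submx_trans (deligne_conj' _ _ hI) _); apply: addsmxS.
    by rewrite conjm_sub sub_capmx IF addrC IW.
  apply: Isum_sub => r s h'; apply: submx_trans (IW _ _) (cW_mono R hW _); ilia.
apply: contraNN v0 => hv'; apply/eqP; apply: (deligne_subW_0 hI hv hv'); ilia.
Qed.

(** Positivity on each cell comes from the polarization, and distinct cells are orthogonal. Its use
    is to make adjoints unique. *)
Lemma mhs_metric_nondeg W Q F N I H z : incr_filtration W ->
  graded_polarized W Q F -> deligne W F N I -> mhs_metric Q I H ->
  (forall x, herm H x z = 0) -> z = 0.
Proof.
move=> hW hP hI hH hz; have gI := deligne_bigraded hI.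
rewrite (bproj_decomp gI z); apply: big1_seq => -[p q] /= hpq.
have sub c d : (z *m bproj N I c d <= I c d)%MS by apply: bproj_sub.
apply/eqP; apply/negPn/negP => nz.
have := deligne_pos hW hP hI (sub p q) nz.
have := hz (z *m bproj N I p q).
rewrite {2}(bproj_decomp gI z) herm_sumr (bigD1_seq (p, q)) ?uniq_zrange2 //=.
rewrite big1 ?addr0 => [h|].
  have := hH _ _ _ _ _ _ (sub p q) (sub p q); rewrite !eqxx /= => <-.
  by rewrite h ltxx.
move=> [c d] /=; rewrite xpair_eqE => h.
apply: etrans (hH _ _ _ _ _ _ (sub p q) (sub c d)) _.
by rewrite eq_sym [q == _]eq_sym (negbTE h).
Qed.

End Herm.

Section Isometry.
Variables (R : realType) (n : nat).
Local Notation C := R[i].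
Local Notation mx := 'M[C]_n.
Local Notation rv := 'rV[C]_n.
Variables (W Q : int -> 'M[rat]_n).
Hypothesis hW : incr_filtration W.
Hypothesis hQ : graded_forms W Q.
Implicit Types (u v w x y z : rv) (F : int -> mx) (I : int -> int -> mx).

Lemma Isum_mul N P I (g : mx) :
  (Isum N P (fun p q => I p q *m g) :=: Isum N P I *m g)%MS.
Proof.
rewrite !IsumE; apply: (big_ind2 (fun X Y : mx => (X :=: Y *m g)%MS)).
- by rewrite mul0mx.
- move=> X Y X' Y' h h'; apply: eqmx_trans (adds_eqmx h h') _.
  exact: eqmx_sym (addsmxMr _ _ _).
- by [].
Qed.

(* Under this hypothesis the error term of elements of H, which lies in
   W_{p+q-2}, is absorbed by the indeterminacy of conj(I^{p,q}). *)
Definition tight I : Prop := forall p q r s : int,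
  \rank (I p q) != 0%N -> \rank (I r s) != 0%N -> r + s <= p + q - 2 -> (r < q) && (s < p).

Lemma deligne_act F N I (g : mx) : inH W Q g -> tight I ->
  deligne W F N I -> deligne W (act g F) N (fun p q => I p q *m g).
Proof.
move=> [hg hr] ht hI; have ug := inG_unit hg.
have fg : row_free g by rewrite row_free_unit.
have [h0 [hn [h1 [hF [hWI hc]]]]] := hI.
split; last split; last split; last split; last split.
- by move=> p q /h0/eqmx0P->; rewrite mul0mx !submx_refl.
- by under eq_bigr do under eq_bigr do rewrite mxrankMfree //.
- by rewrite Isum_mul subMunitP // mul1mx submx_full // -sub1mx.
- move=> p; apply/eqmxP/(eqmx_trans _ (eqmx_sym (Isum_mul _ _ _ _))).
  by apply: eqmxMr; apply/eqmxP.
- move=> k; apply/eqmxP/(eqmx_trans (eqmx_sym (inG_W hg k))).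
  apply/(eqmx_trans _ (eqmx_sym (Isum_mul _ _ _ _))).
  by apply: eqmxMr; apply/eqmxP.
move=> p q; set P := fun r s : int => (r < q) && (s < p).
(* The only non-formal condition: the error lies in W_{p+q-2}, and by [tight] every nonzero cell of
   that space satisfies r < q and s < p. *)
have err x : (x <= I p q)%MS ->
    ((conjm (x *m g) - conjm x *m g)%R <= Isum N P I *m g)%MS.
  have [r0|r0] := eqVneq (\rank (I p q)) 0%N.
    move/eqP: r0; rewrite mxrank_eq0 => /eqP->; rewrite submx0 => /eqP->.
    by rewrite mul0mx !conjm0 mul0mx subrr sub0mx.
  move=> hx; have /submx_trans -> // := hr (p + q) _ (submx_trans hx (deligne_W _ _ hI)).
  rewrite -(inG_W hg) subMunit //; have /eqmxP-> := hWI (p + q - 2).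
  apply: Isum_sub => r s hrs; have [s0|s0] := eqVneq (\rank (I r s)) 0%N.
    by move/eqP: s0; rewrite mxrank_eq0 => /eqP->; rewrite sub0mx.
  by apply: (sub_Isum h0); apply: ht.
apply/andP; rewrite !addsmx_sub !addsmxSr !andbT; split.
  rewrite conjm_subC; apply/rV_subP => _ /submxP[y ->]; rewrite mulmxA -conjm_subC.
  set x := y *m I p q; have hx : (x <= I p q)%MS by apply: submxMl.
  have -> : conjm (x *m g) = conjm x *m g + (conjm (x *m g) - conjm x *m g) by zmod.
  apply: addmx_sub; last by apply: submx_trans (addsmxSr _ _); rewrite Isum_mul err.
  have : (conjm x <= I q p + Isum N P I)%MS.
    by apply: submx_trans (deligne_conj _ _ hI); rewrite conjm_sub.
  move=> /(submxMr g)/submx_trans; apply; rewrite addsmxMr addsmxS //.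
  by rewrite Isum_mul.
apply/rV_subP => _ /submxP[y ->]; rewrite mulmxA.
have : (y *m I q p <= conjm (I p q) + Isum N P I)%MS.
  have /eqmxP-> := hc p q; exact: submx_trans (submxMl _ _) (addsmxSl _ _).
case/sub_addsP=> xx [l [hx hl ->]].
rewrite -[xx]conjmK; set x := conjm xx.
have {}hx : (x <= I p q)%MS by rewrite conjm_subC.
have -> : (conjm x + l) *m g = conjm (x *m g) + (l *m g - (conjm (x *m g) - conjm x *m g)).
  by rewrite mulmxDl; zmod.
apply: adds_sub; first by rewrite conjm_sub submxMr.
by rewrite Isum_mul submx_sub ?err // submxMr.
Qed.

Section Transport.
Variables (f : int -> nat) (g : mx) (F : int -> mx) (N N' : nat).
Variables (I I' : int -> int -> mx) (Hm Hm' : mx).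
Hypotheses (hg : inH W Q g) (hM : inM W Q f F).
Hypotheses (hI : deligne W F N I) (hI' : deligne W (act g F) N' I').
Hypotheses (hH : mhs_metric Q I Hm) (hH' : mhs_metric Q I' Hm').
Hypothesis ht : tight I.

Let hG : inG W Q g := proj1 hg.
Let ug := inG_unit hG.
Let hM' := inG_inM hW hQ hG hM.

Lemma deligne_actE p q : (I' p q :=: I p q *m g)%MS.
Proof.
have [dF [_ [mF _]]] := hM'.
exact: (deligne_unique hW dF mF hI' (deligne_act hg ht hI)).
Qed.

Lemma herm_act x y : herm Hm' (x *m g) (y *m g) = herm Hm x y.
Proof.
have gI := deligne_bigraded hI.
rewrite (bproj_decomp gI x) (bproj_decomp gI y) !mulmx_suml !herm_suml.
apply: eq_bigr => -[p q] _ /=; rewrite !herm_sumr; apply: eq_bigr => -[p' q'] _ /=.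
have hx := bproj_sub N I p q x; have hy := bproj_sub N I p' q' y.
have hx' : (x *m bproj N I p q *m g <= I' p q)%MS by rewrite deligne_actE submxMr.
have hy' : (y *m bproj N I p' q' *m g <= I' p' q')%MS by rewrite deligne_actE submxMr.
apply: etrans (hH' hx' hy') (etrans _ (esym (hH hx hy))).
case: ifP => // /andP[/eqP ep /eqP eq]; rewrite -ep -eq in hy *; congr (_ * _).
by apply: (inG_bil_conj hW hQ hG); [apply: submx_trans hx _ | apply: submx_trans hy _];
  apply: deligne_W hI.
Qed.

Lemma in_grs_act r s X : in_grs W Q I r s X -> in_grs W Q I' r s (invmx g *m X *m g).
Proof.
move=> [[h1 h2] h3].
have Wi k m (u : 'M[C]_(m, n)) : (u <= cW R W k)%MS -> (u *m invmx g <= cW R W k)%MS.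
  by move=> hu; rewrite -subMunitP // (inG_W hG).
have WX k m (u : 'M[C]_(m, n)) : (u <= cW R W k)%MS -> (u *m X <= cW R W k)%MS.
  by move=> hu; apply: submx_trans (submxMr X hu) (h1 k).
split; first split.
- move=> k; rewrite !mulmxA (inG_subW hG); apply: WX; exact: Wi.
- move=> k u v hu hv; rewrite -{2}[u](mulmxKV ug) -{1}[v](mulmxKV ug) !mulmxA.
  by rewrite !(inG_bil hG) ?h2 //; do ?apply: WX; apply: Wi.
- move=> p q; rewrite deligne_actE; apply: submx_trans (submxMr g (h3 p q)).
  rewrite !mulmxA; do 2 apply: submxMr.
  by rewrite -subMunitP // deligne_actE.
Qed.

End Transport.

(** Source and target cells both have indices in [-N, N], so a nonzero map has bidegree in
    [-2N, 2N]. *)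
Lemma in_grs_supp I N r s X : bigraded N I -> in_grs W Q I r s X -> X != 0 ->
  ((r, s) \in zrange2 N.*2).
Proof.
move=> gI [_ hX]; apply: contraNT => hrs.
apply/eqP; apply: (bigraded_ext gI) => p q v hv; rewrite mulmx0.
have hvX := submx_trans (submxMr X hv) (hX p q).
have [h1|/(bigraded_supp gI)/eqmx0P h0] := boolP ((p \in zrange N) && (q \in zrange N)); last first.
  by move: hv; rewrite h0 submx0 => /eqP->; rewrite mul0mx.
have [h2|/(bigraded_supp gI)/eqmx0P h0] :=
  boolP ((p + r \in zrange N) && (q + s \in zrange N)); last first.
  by move: hvX; rewrite h0 submx0 => /eqP->.
by move: hrs h1 h2; rewrite mem_zrange2 !mem_zrange; ilia.
Qed.

Lemma in_tF_alt N I X : in_tF W Q N I X <-> exists Xc : int -> int -> mx,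
    (forall r s, in_grs W Q I r s (Xc r s)) /\
    X = \sum_(x <- zrange2 N.*2 | x.1 < 0) Xc x.1 x.2.
Proof.
split=> -[Xc [h1 h2]]; exists Xc; split=> //; rewrite h2.
  rewrite big_mkcond /= -[RHS](big_zrange2 _ _ (fun a _ => a < 0)).
  by apply: eq_bigr => r _; case: ifP => // hr; rewrite big_pred0.
rewrite -(big_zrange2 _ _ (fun a _ => a < 0)) [RHS]big_mkcond /=.
by apply: eq_bigr => r _; case: ifP => // hr; rewrite big_pred0.
Qed.

(* t_F strictly lowers the Hodge filtration, hence meets the stabilizer of F trivially. *)
Lemma in_tF_lower F N I X p q : deligne W F N I -> in_tF W Q N I X ->
  (I p q *m X <= Isum N (fun a _ => a < p)%R I)%MS.
Proof.
move=> hI /in_tF_alt[Xc [h1 ->]]; have gI := deligne_bigraded hI.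
rewrite mulmx_sumr; apply: (big_ind (fun Y : mx => (Y <= Isum N (fun a _ => a < p)%R I)%MS)).
- exact: sub0mx.
- by move=> X1 X2; apply: addmx_sub.
move=> [r s] /= hr; apply: submx_trans (proj2 (h1 r s) p q) _.
by apply: (sub_Isum (bigraded_supp gI)); ilia.
Qed.

(** Shows that the representative in t_F of a tangent vector is unique, so the differential is a
    well-defined map. *)
Lemma in_tF_stab_eq F N I X Y : deligne W F N I -> in_tF W Q N I X -> in_tF W Q N I Y ->
  in_stab W Q F (X - Y) -> X = Y.
Proof.
move=> hI hX hY [_ hst]; have gI := deligne_bigraded hI.
have [_ [_ [_ [hF _]]]] := hI.
apply: (bigraded_ext gI) => p q v hv; apply/eqP; rewrite -subr_eq0 -mulmxBr.
have lo : (v *m (X - Y) <= Isum N (fun a _ => a < p)%R I)%MS.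
  rewrite mulmxBr; apply: submx_sub; apply: submx_trans (submxMr _ hv) _;
    exact: in_tF_lower hI _.
have hi : (v *m (X - Y) <= Isum N (fun a _ => p <= a)%R I)%MS.
  have /eqmxP <- := hF p; apply: submx_trans (hst p); apply: submxMr.
  exact: submx_trans hv (deligne_F _ _ hI).
rewrite -submx0; apply: submx_trans (_ : (Isum N (fun _ _ => false) I <= 0)%MS); last first.
  exact: Isum_sub.
by apply: (Isum_cap gI _ lo hi) => a b /=; ilia.
Qed.

(** Conjugation by g maps t_F into t_{gF}, so v = g^-1 u g; as g is an isometry of the mixed Hodge
    metrics, the adjoint is conjugated too, and the trace is invariant. *)
Lemma H_isometry f (g : mx) F N N' I I' (Hm Hm' : mx) :
  inH W Q g -> inM W Q f F -> tight I ->
  deligne W F N I -> mhs_metric Q I Hm ->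
  deligne W (act g F) N' I' -> mhs_metric Q I' Hm' ->
  (forall u : mx, in_tF W Q N I u ->
     exists v : mx, in_tF W Q N' I' v /\ in_stab W Q (act g F) (invmx g *m u *m g - v)) /\
  (forall u u' v v' b b' : mx,
     in_tF W Q N I u -> in_tF W Q N I u' ->
     in_tF W Q N' I' v -> in_tF W Q N' I' v' ->
     in_stab W Q (act g F) (invmx g *m u *m g - v) ->
     in_stab W Q (act g F) (invmx g *m u' *m g - v') ->
     adjoint Hm u' b -> adjoint Hm' v' b' ->
     \tr (v *m b') = \tr (u *m b)).
Proof.
move=> hg hM ht hI hH hI' hH'.
have hG : inG W Q g := proj1 hg; have ug := inG_unit hG.
have tr X : in_tF W Q N I X -> in_tF W Q N' I' (invmx g *m X *m g).
  move=> /in_tF_alt[Xc [h1 ->]]; apply/in_tF_alt.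
  exists (fun r s => invmx g *m Xc r s *m g).
  have h1' r s : in_grs W Q I' r s (invmx g *m Xc r s *m g).
    exact: in_grs_act hg hM hI hI' ht _ _ _ (h1 r s).
  split=> //; rewrite mulmx_sumr mulmx_suml big_mkcond [RHS]big_mkcond /=.
  apply: sum_seq_supp; rewrite ?uniq_zrange2 // => -[r s] /=.
  case: ifP; rewrite ?eqxx // => _ nz; apply/andP; split.
    apply: (in_grs_supp (deligne_bigraded hI) (h1 r s)).
    by apply: contraNN nz => /eqP->; rewrite mulmx0 mul0mx.
  exact: (in_grs_supp (deligne_bigraded hI') (h1' r s)).
have uniq X Y : in_tF W Q N I X -> in_tF W Q N' I' Y ->
    in_stab W Q (act g F) (invmx g *m X *m g - Y) -> Y = invmx g *m X *m g.
  by move=> /tr hX hY hs; apply: esym; apply: in_tF_stab_eq hI' hX hY hs.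
split=> [u hu|u u' v v' b b' hu hu' hv hv' hs hs' hb hb'].
  exists (invmx g *m u *m g); split; first exact: tr.
  rewrite subrr; split; first split.
  - by move=> k; rewrite mulmx0 sub0mx.
  - by move=> k x y _ _; rewrite !mulmx0 bil0l bil0r addr0.
  - by move=> p; rewrite mulmx0 sub0mx.
rewrite (uniq _ _ hu hv hs); have ev' := uniq _ _ hu' hv' hs'.
have ha x y := herm_act hg hM hI hI' hH hH' ht x y.
have [_ [_ [_ hP']]] := inG_inM hW hQ hG hM.
(* [adjoint] only gives an identity of pairings: y b' and y g^-1 b g pair equally with every x, and
   nondegeneracy separates them. *)
have eb : b' = invmx g *m b *m g.
  apply/row_matrixP => j; rewrite !rowE; set y := delta_mx _ _.
  apply/eqP; rewrite -subr_eq0; apply/eqP.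
  apply: (mhs_metric_nondeg hW hP' hI' hH') => x.
  rewrite hermBr -hb' ev' -{2}[x](mulmxKV ug) !mulmxA ha -{1}[y](mulmxKV ug) ha.
  by rewrite hb subrr.
by rewrite eb !mulmxA mulmxK // mxtrace_mulC !mulmxA mulmxV // mul1mx.
Qed.

End Isometry.

(** * Hodge numbers *)

Section GradedConj.
Variables (R : realType) (n : nat).
Local Notation C := R[i].
Local Notation mx := 'M[C]_n.
Local Notation rv := 'rV[C]_n.
Variables (W : int -> 'M[rat]_n) (F : int -> mx) (N : nat) (I : int -> int -> mx).
Hypothesis hW : incr_filtration W.
Hypothesis hI : deligne W F N I.
Let gI := deligne_bigraded hI.
Local Notation pi := (bproj N I).

Lemma bproj_W0 m (w : 'M[C]_(m, n)) k p q : (w <= cW R W k)%MS -> k < p + q -> w *m pi p q = 0.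
Proof.
move=> hw hk; have [_ [_ [_ [_ [/(_ k)/eqmxP hWk _]]]]] := hI.
by move: hw; rewrite hWk => /(sub_IsumP gI _ _).1; apply; rewrite -ltNge.
Qed.

(* v |-> conjm v *m pi q p is the conjugation that (F, W) induces on
   the graded object, transported to I. *)
Lemma gconj_err m (v : 'M[C]_(m, n)) p q : (v <= I p q)%MS ->
  ((conjm v - conjm v *m pi q p)%R <= cW R W (p + q - 2)%R)%MS.
Proof.
move=> hv; have : (conjm v <= I q p + Isum N (fun r s => (r < q) && (s < p))%R I)%MS.
  by apply: submx_trans (deligne_conj _ _ hI); rewrite conjm_sub.
case/sub_addsmxP=> -[x l] /= ->; rewrite mulmxDl (bproj_id gI) ?submxMl //.
have -> : l *m Isum N (fun r s => (r < q) && (s < p)) I *m pi q p = 0.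
  by apply: (sub_IsumP gI _ _).1 (submxMl _ _) _ _ _; rewrite ltxx.
rewrite addr0 addrC addKr; apply: submx_trans (submxMl _ _) _.
apply: Isum_sub => r s hrs; apply: submx_trans (deligne_W _ _ hI) (cW_mono R hW _); ilia.
Qed.

Lemma gconjK m (v : 'M[C]_(m, n)) p q : (v <= I p q)%MS ->
  conjm (conjm v *m pi q p) *m pi p q = v.
Proof.
move=> hv; have := gconj_err hv; set l := conjm v - _ => hl.
have -> : conjm v *m pi q p = conjm v - l by rewrite /l opprB addrC addrNK.
rewrite conjmB conjmK mulmxBl (bproj_id gI hv) (@bproj_W0 _ _ (p + q - 2)) ?subr0 //.
  by rewrite conjm_subC conjm_cW.
by lia.
Qed.

(** The graded conjugation maps I^{p,q} to I^{q,p} without loss of rank, since [gconjK] recovers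
    I^{p,q} from its image. *)
Lemma hodge_sym_le p q : (\rank (I p q) <= \rank (I q p))%N.
Proof.
have <- : \rank (conjm (I p q) *m pi q p) = \rank (I p q).
  apply/eqP; rewrite eqn_leq; apply/andP; split.
    by apply: leq_trans (mxrankM_maxl _ _) _; rewrite /conjm mxrank_map.
  rewrite -{1}(gconjK (submx_refl (I p q))).
  by apply: leq_trans (mxrankM_maxl _ _) _; rewrite /conjm mxrank_map.
exact/mxrankS/bproj_sub.
Qed.

Lemma hodge_sym p q : \rank (I p q) = \rank (I q p).
Proof. by apply/eqP; rewrite eqn_leq !hodge_sym_le. Qed.

Lemma csum_col (p : int) : csum N (fun a _ => a == p) I = (\rank (F p) - \rank (F (p + 1)))%N.
Proof.
have [_ [_ [_ [hF _]]]] := hI.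
rewrite !(eqmx_rank (hF _)) !(rank_Isum gI).
rewrite [X in (X - _)%N](_ : _ = csum N (fun a _ => a == p) I + csum N (fun a _ => (p + 1 <= a)%R) I)%N.
  by rewrite addnK.
rewrite /csum (bigID (fun x => x.1 == p)) /=; congr (_ + _)%N; apply: eq_bigl => x; lia.
Qed.

Lemma csum_weight (k : int) :
  csum N (fun a b => a + b == k) I = (\rank (cW R W k) - \rank (cW R W (k - 1)))%N.
Proof.
have [_ [_ [_ [_ [hWk _]]]]] := hI.
rewrite !(eqmx_rank (hWk _)) !(rank_Isum gI).
rewrite [X in (X - _)%N](_ : _ = csum N (fun a b => (a + b == k)%R) I +
  csum N (fun a b => (a + b <= k - 1)%R) I)%N.
  by rewrite addnK.
rewrite /csum (bigID (fun x => x.1 + x.2 == k)) /=.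
by congr (_ + _)%N; apply: eq_bigl => x; lia.
Qed.

Lemma csum1 (P : int -> int -> bool) p q :
  (forall a b, \rank (I a b) != 0%N -> P a b = (a == p) && (b == q)) ->
  csum N P I = \rank (I p q).
Proof.
move=> h; rewrite (csum_eq N h).
rewrite (csumD1 (P' := fun _ _ => false) (bigraded_supp gI) (p := p) (q := q)) //.
by rewrite /csum big_pred0_eq.
Qed.

Lemma csum2 (P : int -> int -> bool) p q p' q' : (p, q) != (p', q') ->
  (forall a b, \rank (I a b) != 0%N ->
     P a b = ((a == p) && (b == q)) || ((a == p') && (b == q'))) ->
  csum N P I = (\rank (I p q) + \rank (I p' q'))%N.
Proof.
move=> ne h; rewrite (csum_eq N h).
rewrite (csumD1 (P' := fun a b => (a == p) && (b == q)) (bigraded_supp gI) (p := p') (q := q')) //.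
  by rewrite (csum1 (p := p) (q := q)).
by rewrite -xpair_eqE eq_sym (negbTE ne).
Qed.

End GradedConj.

Section HodgeNumbers.
Variables (R : realType) (n : nat).
Local Notation C := R[i].
Local Notation mx := 'M[C]_n.
Variables (W Q : int -> 'M[rat]_n) (f : int -> nat).
Hypothesis hW : incr_filtration W.
Implicit Types (F : int -> mx) (I : int -> int -> mx).

(** A zigzag descending in p from p > N. Agreement at (p+1, k-p-1) passes by symmetry to (k-p-1,
    p+1), along the column k-p-1, of fixed dimension, to (k-p-1, p), by symmetry to (p, k-p-1), and
    along the column p to (p, k-p). *)
Lemma hodge_numbers_typeI F F' N I I' : typeI R W Q f ->
  inM W Q f F -> inM W Q f F' -> deligne W F N I -> deligne W F' N I' ->
  forall p q, \rank (I p q) = \rank (I' p q).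
Proof.
move=> [k hk] hM hM' hI hI'.
have t := hk F N I hM hI; have t' := hk F' N I' hM' hI'.
have [_ [rF _]] := hM; have [_ [rF' _]] := hM'.
have s p : \rank (I p (k - p)) = \rank (I (k - p) p) := hodge_sym hW hI _ _.
have s1 p : \rank (I p (k - 1 - p)) = \rank (I (k - 1 - p) p) := hodge_sym hW hI _ _.
have s' p : \rank (I' p (k - p)) = \rank (I' (k - p) p) := hodge_sym hW hI' _ _.
have s1' p : \rank (I' p (k - 1 - p)) = \rank (I' (k - 1 - p) p) := hodge_sym hW hI' _ _.
have col p : (\rank (I p (k - p)%R) + \rank (I p (k - 1 - p)%R) =
              \rank (I' p (k - p)%R) + \rank (I' p (k - 1 - p)%R))%N.
  have ne : (p, k - p) != (p, k - 1 - p) by rewrite xpair_eqE; lia.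
  rewrite -(csum2 hI (P := fun a _ => a == p) ne) => [|a b /t]; last by lia.
  rewrite -(csum2 hI' (P := fun a _ => a == p) ne) => [|a b /t']; last by lia.
  by rewrite (csum_col hI) (csum_col hI') !rF !rF'.
pose D p : int := (\rank (I p (k - p)))%:Z - (\rank (I' p (k - p)))%:Z.
have D0 p : D p = 0.
  move: p; apply: (@int_down_ind _ (N%:Z + 1)) => p.
    move=> hp; have z : ~~ ((p \in zrange N) && (k - p \in zrange N)) by rewrite !mem_zrange; lia.
    have [h0 _] := hI; have [h0' _] := hI'.
    by rewrite /D (eqmx0P (h0 _ _ z)) (eqmx0P (h0' _ _ z)) mxrank0.
  have c1 := col (k - (p + 1)); have e1 := s (p + 1); have e1' := s' (p + 1).
  have e2 := s1 (k - (p + 1)); have e2' := s1' (k - (p + 1)).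
  move: c1 e1 e1' e2 e2'; rewrite /D.
  have -> : k - (k - (p + 1)) = p + 1 by lia.
  have -> : k - 1 - (k - (p + 1)) = p by lia.
  have -> : k - (p + 1) = k - 1 - p by lia.
  have := col p; lia.
move=> p q; have := D0 p; have := col p; rewrite /D.
have := t p q; have := t' p q.
have [->|n1] := eqVneq q (k - p); first by lia.
have [->|n2] := eqVneq q (k - 1 - p); first by lia.
by move: n1 n2; case: (\rank (I p q)) => [|m]; case: (\rank (I' p q)) => [|m'] //; lia.
Qed.

(** The cells (k,k) and (k-1,k-1) fill Gr^W_{2k} and Gr^W_{2k-2}, whose dimensions depend on W
    alone; each column then has a single unknown, of weight 2k-1. *)
Lemma hodge_numbers_typeII F F' N I I' : typeII R W Q f ->
  inM W Q f F -> inM W Q f F' -> deligne W F N I -> deligne W F' N I' ->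
  forall p q, \rank (I p q) = \rank (I' p q).
Proof.
move=> [k hk] hM hM' hI hI'.
have t := hk F N I hM hI; have t' := hk F' N I' hM' hI'.
have [_ [rF _]] := hM; have [_ [rF' _]] := hM'.
have ev j : (j == k) || (j == k - 1) -> \rank (I j j) = \rank (I' j j).
  move=> hj.
  rewrite -(csum1 hI (P := fun a b => a + b == 2 * j)) => [|a b /t]; last by lia.
  rewrite -(csum1 hI' (P := fun a b => a + b == 2 * j)) => [|a b /t']; last by lia.
  by rewrite (csum_weight hI) (csum_weight hI').
have evk := ev k; have evk1 := ev (k - 1); rewrite !eqxx ?orbT /= in evk evk1.
have odd p : \rank (I p (2 * k - 1 - p)) = \rank (I' p (2 * k - 1 - p)).
  have c : csum N (fun a _ => a == p) I = csum N (fun a _ => a == p) I'.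
    by rewrite (csum_col hI) (csum_col hI') !rF !rF'.
  have [hp|hp] := boolP ((p == k) || (p == k - 1)).
    have ne : (p, p) != (p, 2 * k - 1 - p) by rewrite xpair_eqE; lia.
    move: c; rewrite (csum2 hI ne) => [|a b /t]; last by lia.
    rewrite (csum2 hI' ne) => [|a b /t']; last by lia.
    by rewrite ev // => /addnI.
  move: c; rewrite (csum1 hI (p := p) (q := 2 * k - 1 - p)) => [|a b /t]; last by lia.
  by rewrite (csum1 hI' (p := p) (q := 2 * k - 1 - p)) // => a b /t'; lia.
move=> p q; have := t p q; have := t' p q.
have [->|n1] := eqVneq q (2 * k - 1 - p); first by rewrite odd.
have [/andP[/eqP-> /eqP->] _ _|n2] := boolP ((p == k) && (q == k)); first exact: evk.
have [/andP[/eqP-> /eqP->] _ _|n3] := boolP ((p == k - 1) && (q == k - 1)); first exact: evk1.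
by move: n1 n2 n3; case: (\rank (I p q)) => [|m]; case: (\rank (I' p q)) => [|m'] //; lia.
Qed.

Lemma typeI_tight F N I : typeI R W Q f -> inM W Q f F -> deligne W F N I -> tight I.
Proof.
move=> [k hk] hM hI p q r s /(hk _ _ _ hM hI) h1 /(hk _ _ _ hM hI) h2; lia.
Qed.

Lemma typeII_tight F N I : typeII R W Q f -> inM W Q f F -> deligne W F N I -> tight I.
Proof.
move=> [k hk] hM hI p q r s /(hk _ _ _ hM hI) h1 /(hk _ _ _ hM hI) h2; lia.
Qed.

End HodgeNumbers.

(** * Orthonormal frames *)

Section GramSchmidt.
Variables (R : realType) (n : nat).
Local Notation C := R[i].
Local Notation mx := 'M[C]_n.
Local Notation rv := 'rV[C]_n.

Lemma conjmZ m (c : C) (A : 'M[C]_(m, n)) : conjm (c *: A) = c^* *: conjm A.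
Proof. exact: map_mxZ. Qed.

Lemma hermZl (H : mx) c (u v : rv) : herm H (c *: u) v = c * herm H u v.
Proof. by rewrite /herm -!scalemxAl mxE. Qed.

Lemma hermZr (H : mx) c (u v : rv) : herm H u (c *: v) = c^* * herm H u v.
Proof. by rewrite /herm conjmZ linearZ -scalemxAr mxE. Qed.

Lemma herm0l (H : mx) (u : rv) : herm H 0 u = 0.
Proof. exact: bil0l. Qed.

Lemma gramE (H A B : mx) i j :
  (A *m H *m (conjm B)^T) i j = herm H (row i A) (row j B).
Proof.
rewrite /herm -row_mul -row_mul.
by rewrite !mxE; apply: eq_bigr => l _; rewrite !mxE.
Qed.

Variables (H A : mx) (good : rv -> Prop) (stable : mx -> Prop).
Hypothesis herm_sym : forall u v : rv, (u <= A)%MS -> (v <= A)%MS -> herm H v u = (herm H u v)^*.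
Hypothesis herm_pos : forall v : rv, (v <= A)%MS -> v != 0 -> 0 < herm H v v.
Hypothesis good0 : good 0.
Hypothesis goodZ : forall c (v : rv), (v <= A)%MS -> 0 < c -> good v -> good (c *: v).
Hypothesis good_ex : forall B : mx, stable B -> (B <= A)%MS -> B != 0 ->
  exists v : rv, [/\ (v <= B)%MS, v != 0 & good v].
Hypothesis stable_orth : forall (B : mx) (v : rv), stable B -> (B <= A)%MS -> (v <= A)%MS -> good v ->
  stable (B :&: kermx (H *m (conjm v)^T))%MS.

(** Gram-Schmidt with a side condition: [good] will mean fixed by the graded conjugation and
    [stable] invariant under it, so that the complex process yields real vectors. Both are trivial
    off the diagonal. *)
Lemma orth_seq r (B : mx) : stable B -> (B <= A)%MS -> \rank B = r ->
  exists e : nat -> rv, [/\ forall j, (e j <= B)%MS, forall j, good (e j),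
    forall j, (r <= j)%N -> e j = 0 &
    forall j k, herm H (e j) (e k) = ((j == k) && (j < r)%N)%:R].
Proof.
elim: r B => [|r IH] B sB BA rB.
  exists (fun=> 0); split=> // [j|j k]; first exact: sub0mx.
  by rewrite herm0l andbF.
have [|v0 [hv0 nv0 gv0]] := good_ex sB BA; first by rewrite -mxrank_eq0 rB.
have p0 := herm_pos (submx_trans hv0 BA) nv0.
pose c := (sqrtC (herm H v0 v0))^-1; pose v := c *: v0.
have cp : 0 < c by rewrite invr_gt0 sqrtC_gt0.
have hv : (v <= B)%MS by apply: scalemx_sub.
have vA := submx_trans hv BA.
have gv : good v by apply: goodZ => //; apply: submx_trans hv0 BA.
have vv : herm H v v = 1.
  rewrite /v hermZl hermZr (conj_Creal (gtr0_real cp)) mulrA -expr2 /c exprVn sqrtCK.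
  by rewrite mulVf // gt_eqF.
pose M := H *m (conjm v)^T.
have kerP (u : rv) : (u <= kermx M)%MS -> herm H u v = 0.
  by move=> /sub_kermxP; rewrite /M mulmxA /herm => ->; rewrite mxE.
have rB' : \rank (B :&: kermx M)%MS = r.
  have := mxrank_mul_ker B M; rewrite rB.
  suff -> : \rank (B *m M) = 1%N by move=> [].
  apply/eqP; rewrite eqn_leq rank_leq_col lt0n mxrank_eq0.
  apply/eqP => BM; have /submxP[y yB] := hv.
  have : herm H v v = 0 by rewrite /herm -mulmxA -/M yB -mulmxA BM mulmx0 mxE.
  by rewrite vv => /eqP; rewrite oner_eq0.
have [e [e1 e2 e3 e4]] := IH _ (stable_orth sB BA vA gv) (submx_trans (capmxSl _ _) BA) rB'.
have eB j : (e j <= B)%MS by apply: submx_trans (e1 j) (capmxSl _ _).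
have ev j : herm H (e j) v = 0 by apply/kerP/(submx_trans (e1 j) (capmxSr _ _)).
have ve j : herm H v (e j) = 0.
  by rewrite (herm_sym (submx_trans (eB j) BA) vA) ev conjC0.
exists (fun j => if j is j'.+1 then e j' else v); split.
- by case.
- by case.
- by case=> // j; exact: e3.
- by case=> [|j] [|k]; rewrite ?vv ?ve ?ev //= e4 eqSS ltnS.
Qed.

Lemma gram_eqmx (B : mx) : (B <= A)%MS -> B *m H *m (conjm B)^T = pid_mx (\rank A) ->
  (B :=: A)%MS.
Proof.
move=> BA hB; apply/eqmxP; rewrite -(geq_leqif (mxrank_leqif_eq BA)).
rewrite -(@rank_pid_mx C n n (\rank A)) ?rank_leq_col // -hB -mulmxA.
exact: mxrankM_maxl.
Qed.

(** The basis is padded with zero rows to a square matrix, whence the Gram matrix [pid_mx] instead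
    of an identity of varying size. *)
Lemma orth_basis : stable A -> exists B : mx,
  [/\ (B <= A)%MS, B *m H *m (conjm B)^T = pid_mx (\rank A),
      pid_mx (\rank A) *m B = B & forall j, good (row j B)].
Proof.
move=> sA; have [e [e1 e2 e3 e4]] := orth_seq sA (submx_refl A) erefl.
exists (\matrix_(j < n) e j); split.
- by apply/row_subP => j; rewrite rowK.
- by apply/matrixP => j k; rewrite gramE !rowK e4 mxE.
- apply/matrixP => j k; rewrite !mxE (bigD1 j) //= big1 ?addr0 => [|l lj].
    rewrite !mxE eqxx /=; case: ltnP => hj; rewrite ?mul1r //.
    by rewrite mul0r e3 // mxE.
  by rewrite !mxE eq_sym (inj_eq val_inj) (negbTE lj) mul0r.
- by move=> j; rewrite rowK.
Qed.

End GramSchmidt.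

(** * Hodge forms and frames compatible with the graded conjugation *)

Section Polarization.
Variables (R : realType) (n : nat).
Local Notation C := R[i].
Local Notation mx := 'M[C]_n.
Local Notation rv := 'rV[C]_n.
Variables (W Q : int -> 'M[rat]_n) (F : int -> mx) (N : nat) (I : int -> int -> mx).
Hypothesis hW : incr_filtration W.
Hypothesis hQ : graded_forms W Q.
Hypothesis hP : graded_polarized W Q F.
Hypothesis hI : deligne W F N I.
Let gI := deligne_bigraded hI.
Local Notation pi := (bproj N I).

Definition hodge_form (p q : int) : mx := 'i ^ (p - q) *: cQ R Q (p + q).

Lemma herm_hodge p q (u v : rv) :
  herm (hodge_form p q) u v = 'i ^ (p - q) * bil (cQ R Q (p + q)) u (conjm v).
Proof. by rewrite /herm /bil -scalemxAr -scalemxAl mxE. Qed.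

Lemma conj_Xi (m : int) : ('i ^ m : C)^* = 'i ^ (- m).
Proof. by rewrite fmorphXz /= conjCi -invCi exprz_inv. Qed.

(** Matches the parity of Q_{p+q} with the conjugate of i^{p-q}; this is what makes the Hodge form
    hermitian. *)
Lemma hodge_sign (p q : int) : 'i ^ (p - q) * (-1) ^ (p + q) = 'i ^ (q - p) :> C.
Proof.
have ni : ('i : C) != 0 by apply: neq0Ci.
have i4 : ('i : C) ^ (4 : int) = 1.
  by rewrite -[LHS]/('i ^+ 4) (exprM _ 2 2) sqrCi expr2 mulN1r opprK.
have -> : (-1 : C) = 'i ^ (2 : int) by rewrite -[RHS]/('i ^+ 2) sqrCi.
rewrite exprz_exp -expfzDr //.
have -> : p - q + 2 * (p + q) = q - p + 4 * p by lia.
by rewrite expfzDr // -exprz_exp i4 exp1rz mulr1.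
Qed.

Lemma hodge_form_sym p q (u v : rv) :
  herm (hodge_form p q) v u = (herm (hodge_form p q) u v)^*.
Proof.
rewrite !herm_hodge rmorphM /= conj_bil conjmK conj_Xi opprB -(hodge_sign p q).
by rewrite (bil_sym _ _ _ hQ) mulrA.
Qed.

Lemma bil_gconj_r p q k (u v : rv) : p + q = k -> (u <= cW R W k)%MS -> (v <= I p q)%MS ->
  bil (cQ R Q k) u (conjm v *m pi q p) = bil (cQ R Q k) u (conjm v).
Proof.
move=> hk hu hv; have := gconj_err hW hI hv; set l := _ - _ => hl.
have e : conjm v = conjm v *m pi q p + l by rewrite /l addrC addrNK.
rewrite [in RHS]e bilDr [X in _ = _ + X](bil_rad' hW hQ) ?addr0 //.
by apply: submx_trans hl (cW_mono R hW _); lia.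
Qed.

Lemma gconj_W p q k (v : rv) : p + q = k -> (v <= I p q)%MS ->
  (conjm v *m pi q p <= cW R W k)%MS.
Proof.
by move=> <- _; rewrite addrC; apply: submx_trans (bproj_sub _ _ _ _ _) (deligne_W _ _ hI).
Qed.

Lemma gconj_isometry p q (u v : rv) : (u <= I p q)%MS -> (v <= I p q)%MS ->
  herm (hodge_form q p) (conjm u *m pi q p) (conjm v *m pi q p) =
  (herm (hodge_form p q) u v)^*.
Proof.
move=> hu hv; rewrite !herm_hodge rmorphM /= conj_bil conjmK conj_Xi opprB.
congr (_ * _); rewrite addrC.
have vW : (v <= cW R W (p + q))%MS by apply: submx_trans hv (deligne_W _ _ hI).
have sW : (conjm (conjm v *m pi q p) <= cW R W (p + q))%MS.
  by rewrite conjm_subC conjm_cW; apply: gconj_W.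
rewrite (bil_sym _ _ _ hQ) bil_gconj_r // -(bil_sym _ _ _ hQ).
rewrite -[bil _ _ _]conjCK conj_bil conjmK conjmK bil_gconj_r //; last first.
  exact: submx_trans hu (deligne_W _ _ hI).
by rewrite conj_bil conjmK.
Qed.

(** First bilinear relation. For c < a, conj w may be replaced by its component in I^{d,c}, and d =
    k - c >= k - a + 1 places it in F^{k-a+1}, orthogonal to F^a. *)
Lemma hodge_orth a b c d k (u w : rv) : a + b = k -> c + d = k -> a != c ->
  (u <= I a b)%MS -> (w <= I c d)%MS -> bil (cQ R Q k) u (conjm w) = 0.
Proof.
wlog ca : a b c d u w / c < a.
  move=> th hab hcd ne hu hw; have /orP[h|h] := lt_total ne; last exact: (th a b c d).
  have := th c d a b w u h hcd hab; rewrite gt_eqF // => /(_ isT hw hu) e.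
  rewrite -[bil _ u _]conjCK conj_bil conjmK (bil_sym _ _ _ hQ) e.
  by rewrite mulr0 conjC0.
move=> hab hcd _ hu hw.
have uW : (u <= cW R W k)%MS by rewrite -hab; apply: submx_trans hu (deligne_W _ _ hI).
rewrite -(bil_gconj_r hcd uW hw).
have [h _] := hP hab; apply: h; rewrite sub_capmx.
  by rewrite uW (submx_trans hu (deligne_F _ _ hI)).
rewrite (gconj_W hcd hw) andbT; apply: submx_trans (bproj_sub _ _ _ _ _) _.
have [_ [_ [_ [hF _]]]] := hI; have /eqmxP-> := hF (k - a + 1).
by apply: (sub_Isum (bigraded_supp gI)); lia.
Qed.

Lemma hodge_basis_ne p q : exists B : mx,
  [/\ (B <= I p q)%MS, B *m hodge_form p q *m (conjm B)^T = pid_mx (\rank (I p q))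
   & pid_mx (\rank (I p q)) *m B = B].
Proof.
have [] := @orth_basis R n (hodge_form p q) (I p q) (fun=> True) (fun=> True) => //.
- by move=> u v _ _; apply: hodge_form_sym.
- by move=> v hv nv; rewrite herm_hodge (deligne_pos hW hP hI).
- move=> B _ _ nB; exists (nz_row B); rewrite nz_row_eq0.
  by split=> //; apply: nz_row_sub.
- by move=> B [h1 h2 h3 _]; exists B.
Qed.

Lemma hodge_basis_eq p : exists B : mx,
  [/\ (B <= I p p)%MS, B *m hodge_form p p *m (conjm B)^T = pid_mx (\rank (I p p)),
   pid_mx (\rank (I p p)) *m B = B & conjm B *m pi p p = B].
Proof.
have [] := @orth_basis R n (hodge_form p p) (I p p) (fun v => conjm v *m pi p p = v)
  (fun B => forall v : rv, (v <= B)%MS -> (conjm v *m pi p p <= B)%MS) => //.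
- by move=> u v _ _; apply: hodge_form_sym.
- by move=> v hv nv; rewrite herm_hodge (deligne_pos hW hP hI).
- by rewrite conjm0 mul0mx.
- move=> c v _ cp gv.
  by rewrite conjmZ (conj_Creal (gtr0_real cp)) -scalemxAl gv.
- move=> B sB BI nB; pose v := nz_row B.
  have hv : (v <= B)%MS by apply: nz_row_sub.
  have nv : v != 0 by rewrite nz_row_eq0.
  have vK := gconjK hW hI (submx_trans hv BI).
  (* A real vector from any v: v plus its conjugate or, if that vanishes, i v, since v is then
     purely imaginary. *)
  have [w0|nw] := eqVneq (v + conjm v *m pi p p) 0.
    exists ('i *: v); split; first exact: scalemx_sub.
      by rewrite scaler_eq0 (negbTE (neq0Ci _)).
    rewrite conjmZ conjCi -scalemxAl.
    have -> : conjm v *m pi p p = - v by apply/eqP; rewrite -subr_eq0 opprK addrC w0.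
    by rewrite scaleNr scalerN opprK.
  exists (v + conjm v *m pi p p); split=> //; first by rewrite addmx_sub // sB.
  by rewrite conjmD mulmxDl vK addrC.
- move=> B v sB BI vI gv u; rewrite !sub_capmx => /andP[uB /sub_kermxP uk].
  rewrite sB //=; apply/sub_kermxP; apply/matrixP => j k; rewrite !ord1 mulmxA [RHS]mxE.
  rewrite -[LHS]/(herm (hodge_form p p) _ v) -[v]gv gconj_isometry //; last first.
    exact: submx_trans uB BI.
  have -> : herm (hodge_form p p) u v = 0; last by rewrite conjC0.
  by rewrite /herm -mulmxA uk mxE.
- by move=> v _; apply: bproj_sub.
- move=> B [h1 h2 h3 h4]; exists B; split=> //; apply/row_matrixP => j.
  by rewrite -[RHS]h4 row_mul /conjm map_row.
Qed.

Definition hodge_frame (B : int -> int -> mx) : Prop := forall p q,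
  [/\ (B p q :=: I p q)%MS,
      B p q *m hodge_form p q *m (conjm (B p q))^T = pid_mx (\rank (I p q)),
      pid_mx (\rank (I p q)) *m B p q = B p q & conjm (B p q) *m pi q p = B q p].

Lemma hodge_frame_exists : exists B, hodge_frame B.
Proof.
have h (x : int * int) : exists B : mx,
  [/\ (B <= I x.1 x.2)%MS,
      B *m hodge_form x.1 x.2 *m (conjm B)^T = pid_mx (\rank (I x.1 x.2)),
      pid_mx (\rank (I x.1 x.2)) *m B = B & x.1 = x.2 -> conjm B *m pi x.1 x.1 = B].
  case: x => p q /=; have [<-|ne] := eqVneq p q.
    by have [B [h1 h2 h3 h4]] := hodge_basis_eq p; exists B; split.
  have [B [h1 h2 h3]] := hodge_basis_ne p q; exists B; split=> // e.
  by rewrite e eqxx in ne.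
have [b hb] := choice h.
have subb p q : (b (p, q) <= I p q)%MS by case: (hb (p, q)).
(* Half of the frames are chosen, the others are their conjugates, orthonormal by [gconj_isometry];
   on the diagonal the chosen frame is its own conjugate. *)
exists (fun p q => if q <= p then b (p, q) else conjm (b (q, p)) *m pi p q) => p q.
have main : let X := if q <= p then b (p, q) else conjm (b (q, p)) *m pi p q in
  [/\ (X <= I p q)%MS, X *m hodge_form p q *m (conjm X)^T = pid_mx (\rank (I p q))
    & pid_mx (\rank (I p q)) *m X = X].
  case: leP => qp /=; first by case: (hb (p, q)).
  have [/= h1 h2 h3 _] := hb (q, p); split; first exact: bproj_sub.
    apply/matrixP => j k; rewrite gramE !row_mul.
    rewrite [row j (conjm _)](_ : _ = conjm (row j (b (q, p)))); last by rewrite /conjm map_row.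
    rewrite [row k (conjm _)](_ : _ = conjm (row k (b (q, p)))); last by rewrite /conjm map_row.
    rewrite gconj_isometry -?gramE ?h2; try exact: submx_trans (row_sub _ _) h1.
    by rewrite (hodge_sym hW hI q p) !mxE rmorph_nat.
  rewrite mulmxA -[in RHS]h3 conjmM (hodge_sym hW hI p q); congr (_ *m _ *m _).
  by rewrite /conjm map_pid_mx.
case: main => m1 m2 m3; split; [exact: gram_eqmx m1 m2 | exact: m2 | exact: m3 |].
case: (ltgtP q p) => [qp|pq|e] /=.
- by [].
- by apply: (gconjK hW hI); apply: subb.
- by rewrite e; have [_ _ _ ->] := hb (p, p).
Qed.

End Polarization.

(** * Transitivity *)

Section Transitivity.
Variables (R : realType) (n : nat).
Local Notation C := R[i].
Local Notation mx := 'M[C]_n.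
Local Notation rv := 'rV[C]_n.
Variables (W Q : int -> 'M[rat]_n) (F F' : int -> mx) (N : nat) (I I' : int -> int -> mx).
Hypothesis hW : incr_filtration W.
Hypothesis hQ : graded_forms W Q.
Hypothesis hP : graded_polarized W Q F.
Hypothesis hP' : graded_polarized W Q F'.
Hypothesis hI : deligne W F N I.
Hypothesis hI' : deligne W F' N I'.
Hypothesis rI : forall p q, \rank (I p q) = \rank (I' p q).
Variables B B' : int -> int -> mx.
Hypothesis hB : hodge_frame Q N I B.
Hypothesis hB' : hodge_frame Q N I' B'.
Let gI := deligne_bigraded hI.
Local Notation pi := (bproj N I).

(** For v in I^{p,q}, v H (conj B)^T is the row of coordinates of v in the orthonormal frame B;
    multiplying by B' reads them in the target frame. *)
Definition frame_map : mx :=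
  \sum_(x <- zrange2 N) pi x.1 x.2 *m
    (hodge_form R Q x.1 x.2 *m (conjm (B x.1 x.2))^T *m B' x.1 x.2).
Local Notation g := frame_map.

Lemma frame_mapE p q : B p q *m g = B' p q.
Proof.
have [eB gB pB _] := hB p q; have [eB' _ pB' _] := hB' p q.
have sB : (B p q <= I p q)%MS by rewrite eB.
rewrite /g mulmx_sumr.
have [hpq|npq] := boolP ((p, q) \in zrange2 N); last first.
  have z : I p q = 0 by apply/eqmx0P; apply: (bigraded_supp gI); rewrite -mem_zrange2.
  have -> : B' p q = 0 by apply/eqP; rewrite -mxrank_eq0 eB' -rI z mxrank0.
  have -> : B p q = 0 by apply/eqP; rewrite -mxrank_eq0 eB z mxrank0.
  by apply: big1 => x _; rewrite mul0mx.
rewrite (bigD1_seq (p, q)) ?uniq_zrange2 //= mulmxA (bproj_id gI sB).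
rewrite !mulmxA gB rI pB' big1 ?addr0 // => -[c d] /=; rewrite xpair_eqE => h.
by rewrite mulmxA (bproj_0 gI sB) ?mul0mx // eq_sym [q == _]eq_sym.
Qed.

Lemma frame_map_I p q : (I p q *m g :=: I' p q)%MS.
Proof.
have [eB _ _ _] := hB p q; have [eB' _ _ _] := hB' p q.
by apply: eqmx_trans (eqmxMr g (eqmx_sym eB)) _; rewrite frame_mapE.
Qed.

Lemma frame_map_unit : g \in unitmx.
Proof.
rewrite -row_full_unit -sub1mx; have [_ _ h1] := deligne_bigraded hI'.
apply: submx_trans h1 _; apply: Isum_sub => p q _.
by rewrite -frame_map_I submxMl.
Qed.

Lemma frame_map_Isum P : (Isum N P I *m g :=: Isum N P I')%MS.
Proof.
apply/eqmxP/andP; split.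
  rewrite -Isum_mul; apply: Isum_sub => p q hpq; rewrite frame_map_I.
  by apply: (sub_Isum (bigraded_supp (deligne_bigraded hI'))).
apply: Isum_sub => p q hpq; rewrite -frame_map_I submxMr //.
by apply: (sub_Isum (bigraded_supp gI)).
Qed.

Lemma frame_map_F p : (F p *m g :=: F' p)%MS.
Proof.
have [_ [_ [_ [/(_ p)/eqmxP hF _]]]] := hI; have [_ [_ [_ [/(_ p)/eqmxP hF' _]]]] := hI'.
apply: eqmx_trans (eqmxMr g hF) (eqmx_trans (frame_map_Isum _) (eqmx_sym hF')).
Qed.

Lemma frame_map_W k : (cW R W k *m g :=: cW R W k)%MS.
Proof.
have [_ [_ [_ [_ [/(_ k)/eqmxP hF _]]]]] := hI.
have [_ [_ [_ [_ [/(_ k)/eqmxP hF' _]]]]] := hI'.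
apply: eqmx_trans (eqmxMr g hF) (eqmx_trans (frame_map_Isum _) (eqmx_sym hF')).
Qed.

Lemma frame_map_subW m (v : 'M[C]_(m, n)) k : (v <= cW R W k)%MS -> (v *m g <= cW R W k)%MS.
Proof. by move=> /(submxMr g); rewrite frame_map_W. Qed.

(** The frames make g intertwine the two graded conjugations exactly, and each differs from complex
    conjugation by an error in W_{p+q-2}. *)
Lemma frame_map_real_I p q (x : rv) : (x <= I p q)%MS ->
  ((conjm (x *m g) - conjm x *m g)%R <= cW R W (p + q - 2)%R)%MS.
Proof.
have [eB _ _ cB] := hB p q; have [eB' _ _ cB'] := hB' p q.
move=> hx; have := hx; rewrite -eB => /submxP[y def].
have e1 := gconj_err hW hI hx.
have hx' : (x *m g <= I' p q)%MS by rewrite -frame_map_I submxMr.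
have e2 := gconj_err hW hI' hx'.
have s : conjm (x *m g) *m bproj N I' q p = conjm x *m pi q p *m g.
  have -> : x *m g = y *m B' p q by rewrite def -mulmxA frame_mapE.
  rewrite conjmM -mulmxA cB' -frame_mapE def conjmM.
  by rewrite -(mulmxA _ (conjm (B p q))) cB mulmxA.
have -> : conjm (x *m g) - conjm x *m g =
  (conjm (x *m g) - conjm (x *m g) *m bproj N I' q p) - (conjm x - conjm x *m pi q p) *m g.
  by rewrite s mulmxBl; move: (conjm (x *m g)) => z; zmod.
by apply: submx_sub e2 (frame_map_subW e1).
Qed.

Lemma frame_map_real : real_mod W 2 g.
Proof.
move=> k v hv; pose D (u : rv) : rv := conjm (u *m g) - conjm u *m g.
have DD u w : D (u + w) = D u + D w.
  by rewrite /D conjmD !mulmxDl conjmD opprD addrACA.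
have D0 : D 0 = 0 by rewrite /D conjm0 !mul0mx conjm0 subrr.
rewrite -/(D v) (bproj_decomp gI v) (big_morph D DD D0).
apply: (big_ind (fun u : rv => (u <= cW R W (k - 2))%MS)).
- exact: sub0mx.
- by move=> u w; apply: addmx_sub.
move=> [p q] _ /=; have [pqk|pqk] := leP (p + q) k.
  apply: submx_trans (frame_map_real_I (bproj_sub _ _ _ _ _)) (cW_mono R hW _); lia.
by rewrite (bproj_W0 hI hv pqk) D0 sub0mx.
Qed.

Lemma frame_map_herm p q (u w : rv) : (u <= I p q)%MS -> (w <= I p q)%MS ->
  herm (hodge_form R Q p q) (u *m g) (w *m g) = herm (hodge_form R Q p q) u w.
Proof.
have [eB gB _ _] := hB p q; have [_ gB' _ _] := hB' p q.
move=> hu hw; have /submxP[y ->] : (u <= B p q)%MS by rewrite eB.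
have /submxP[z ->] : (w <= B p q)%MS by rewrite eB.
rewrite -(mulmxA y) -(mulmxA z) frame_mapE.
have hM (A : mx) : herm (hodge_form R Q p q) (y *m A) (z *m A) =
    (y *m (A *m hodge_form R Q p q *m (conjm A)^T) *m (conjm z)^T) 0 0.
  by rewrite /herm conjmM trmx_mul !mulmxA.
by rewrite !hM gB gB' rI.
Qed.

(** Cell by cell: weights below k lie in the radical, distinct cells of weight k are orthogonal on
    both sides, and within one cell the frames give the equality. *)
Lemma frame_map_bil_conj k (u w : rv) : (u <= cW R W k)%MS -> (w <= cW R W k)%MS ->
  bil (cQ R Q k) (u *m g) (conjm (w *m g)) = bil (cQ R Q k) u (conjm w).
Proof.
have cWk (v : rv) j : (v <= cW R W j)%MS -> (conjm v <= cW R W j)%MS.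
  by rewrite conjm_subC conjm_cW.
rewrite -!hermE => hu hw.
rewrite [u](bproj_decomp gI) [w](bproj_decomp gI) !mulmx_suml !herm_suml.
apply: eq_bigr => -[a b] _ /=; rewrite !herm_sumr; apply: eq_bigr => -[c d] _ /=.
have hu' := bproj_sub N I a b u; have hw' := bproj_sub N I c d w.
have [hab|hab] := ltP k (a + b); first by rewrite (bproj_W0 hI hu hab) mul0mx !herm0l.
have [hcd|hcd] := ltP k (c + d); first by rewrite (bproj_W0 hI hw hcd) mul0mx !herm0r.
move: (u *m _) hu' (w *m _) hw' => {hu hw}u hu {}w hw; rewrite !hermE.
have uW : (u <= cW R W (a + b))%MS := submx_trans hu (deligne_W _ _ hI).
have wW : (w <= cW R W (c + d))%MS := submx_trans hw (deligne_W _ _ hI).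
have uk : (u <= cW R W k)%MS := submx_trans uW (cW_mono R hW hab).
have wk : (w <= cW R W k)%MS := submx_trans wW (cW_mono R hW hcd).
have [ek|nk] := eqVneq (a + b) k; last first.
  have uk1 : (u <= cW R W (k - 1))%MS by apply: submx_trans uW (cW_mono R hW _); lia.
  rewrite (bil_rad hW hQ _ uk1) ?cWk // (bil_rad hW hQ _ (frame_map_subW uk1)) //.
  by rewrite cWk // frame_map_subW.
have [ek'|nk] := eqVneq (c + d) k; last first.
  have wk1 : (w <= cW R W (k - 1))%MS by apply: submx_trans wW (cW_mono R hW _); lia.
  rewrite (bil_rad' hW hQ uk) ?cWk // (bil_rad' hW hQ (frame_map_subW uk)) //.
  by rewrite cWk // frame_map_subW.
have [eac|nac] := eqVneq a c; last first.
  rewrite (hodge_orth hW hQ hP hI ek ek' nac hu hw).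
  by apply: (hodge_orth hW hQ hP' hI' ek ek' nac); rewrite -frame_map_I submxMr.
have ebd : b = d by lia.
rewrite -eac -ebd in hw; have := frame_map_herm hu hw; rewrite !herm_hodge ek.
by apply: mulfI; rewrite expfz_neq0 // neq0Ci.
Qed.

Lemma frame_map_inH : inH W Q g.
Proof.
split; last exact: frame_map_real.
split; first exact: frame_map_unit.
split; first by move=> k; apply/eqmxP; apply: frame_map_W.
split=> [k v hv|k u v hu hv].
  by apply: submx_trans (frame_map_real hv) (cW_mono R hW _); lia.
have hv' : (conjm v <= cW R W k)%MS by rewrite conjm_subC conjm_cW.
rewrite -[in RHS](conjmK v) -(frame_map_bil_conj hu hv').
(* Passage from the sesquilinear to the bilinear identity: applied to conj v, it differs from the
   latter by a term in the radical. *)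
have r : ((conjm (conjm v *m g) - v *m g)%R <= cW R W (k - 1))%MS.
  rewrite -{2}(conjmK v); apply: submx_trans (frame_map_real hv') (cW_mono R hW _); lia.
have -> : conjm (conjm v *m g) = v *m g + (conjm (conjm v *m g) - v *m g).
  by rewrite addrC addrNK.
by rewrite bilDr [X in _ = _ + X](bil_rad' hW hQ (frame_map_subW hu) r) addr0.
Qed.

End Transitivity.

Lemma H_transitive (R : realType) (n : nat) (W Q : int -> 'M[rat]_n) (f : int -> nat)
    (F F' : int -> 'M[R[i]]_n) :
  incr_filtration W -> graded_forms W Q -> typeI R W Q f \/ typeII R W Q f ->
  inM W Q f F -> inM W Q f F' ->
  exists g, inH W Q g /\ forall p, (F' p == act g F p)%MS.
Proof.
move=> hW hQ ht hM hM'.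
have [dF [_ [mF hP]]] := hM; have [dF' [_ [mF' hP']]] := hM'.
have [N1 h1] := deligne_exists hW dF mF; have [N2 h2] := deligne_exists hW dF' mF'.
have [I hI] := h1 _ (leq_maxl N1 N2); have [I' hI'] := h2 _ (leq_maxr N1 N2).
have rI p q : \rank (I p q) = \rank (I' p q).
  case: ht => ht; first exact: (hodge_numbers_typeI hW ht hM hM' hI hI').
  exact: (hodge_numbers_typeII ht hM hM' hI hI').
have [B hB] := hodge_frame_exists hW hQ hP hI.
have [B' hB'] := hodge_frame_exists hW hQ hP' hI'.
exists (frame_map Q (maxn N1 N2) I B B'); split.
  exact: (frame_map_inH hW hQ hP hP' hI hI' rI hB hB').
by move=> p; apply/eqmxP; apply: eqmx_sym; apply: (frame_map_F hI hI' rI hB hB').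
Qed.

Theorem theorem2p19 (R : realType) (n : nat)
    (W Q : int -> 'M[rat]_n) (f : int -> nat) :
  incr_filtration W -> graded_forms W Q ->
  typeI R W Q f \/ typeII R W Q f ->
  (* H acts on M *)
  (forall (g : 'M[R[i]]_n) (F : int -> 'M[R[i]]_n),
     inH W Q g -> inM W Q f F -> inM W Q f (act g F)) /\
  (* transitively *)
  (forall F F' : int -> 'M[R[i]]_n, inM W Q f F -> inM W Q f F' ->
     exists g, inH W Q g /\ forall p, (F' p == act g F p)%MS) /\
  (* by isometries: L_{g*} : T_F M -> T_{g.F} M, computed in the identification
     T_F M = t_F, sends u to the v in t_{g.F} with g^-1 u g - v in Lie Stab(g.F) *)
  (forall (g : 'M[R[i]]_n) (F : int -> 'M[R[i]]_n)
          (N N' : nat) (I I' : int -> int -> 'M[R[i]]_n) (Hm Hm' : 'M[R[i]]_n),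
     inH W Q g -> inM W Q f F ->
     deligne W F N I -> mhs_metric Q I Hm ->
     deligne W (act g F) N' I' -> mhs_metric Q I' Hm' ->
     (forall u, in_tF W Q N I u ->
        exists v, in_tF W Q N' I' v /\ in_stab W Q (act g F) (invmx g *m u *m g - v)) /\
     (forall u u' v v' b b' : 'M[R[i]]_n,
        in_tF W Q N I u -> in_tF W Q N I u' ->
        in_tF W Q N' I' v -> in_tF W Q N' I' v' ->
        in_stab W Q (act g F) (invmx g *m u *m g - v) ->
        in_stab W Q (act g F) (invmx g *m u' *m g - v') ->
        adjoint Hm u' b -> adjoint Hm' v' b' ->
        \tr (v *m b') = \tr (u *m b))).
Proof.
move=> hW hQ ht; split=> [g F [hg _]|]; first exact: inG_inM.
split=> [F F'|g F N N' I I' Hm Hm' hg hM hI hH hI' hH']; first exact: H_transitive.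
apply: (H_isometry hW hQ hg hM _ hI hH hI' hH').
by case: ht => ht; [apply: typeI_tight ht hM hI | apply: typeII_tight ht hM hI].
Qed.
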